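(* Let $(X,d)$ be a geodesic Gromov-hyperbolic space, $o\in X$ a basepoint, and $\mu$ a countably supported non-elementary probability measure on $\mathrm{Isom}(X)$. Suppose that $\mu$ has a finite exponential moment, i.e. there is $\alpha>0$ with $\int e^{\alpha\, d(g\cdot o,o)}\,d\mu(g)<+\infty$. Let $z_n=L_n\cdot o$, let $\ell_\mu$ be the drift, $\sigma_\mu^2$ the variance in the central limit theorem for $d(z_n,o)$, and $\Lambda(\lambda)=\lim_{n\to\infty}\frac1n\log\mathbb{E}[e^{\lambda d(z_n,o)}]$. Then $$\lim_{\lambda\to 0}\frac{\Lambda(\lambda)-\lambda\ell_\mu}{\lambda^2}=\frac{\sigma_\mu^2}{2}.$$
   Context: $(X,d)$ is Gromov-hyperbolic if there is $\delta\ge 0$ such that $(x|y)_o\ge \min\{(x|z)_o,(z|y)_o\}-\delta$ for all $x,y,z,o\in X$, where $(x|y)_o=\frac12(d(x,o)+d(y,o)-d(x,y))$. A probability measure on $\mathrm{Isom}(X)$ is non-elementary if the semigroup generated by its support contains two independent loxodromic elements (loxodromic isometries whose pairs of fixed points on the Gromov boundary are disjoint). Let $X_1,X_2,\dots$ be i.i.d. random elements of $\mathrm{Isom}(X)$ with law $\mu$ and $L_n=X_n\cdots X_1$. The drift $\ell_\mu\in[0,\infty)$ is the almost sure limit of $\frac1n d(z_n,o)$. Under the hypotheses, $\frac{1}{\sqrt n}(d(z_n,o)-n\ell_\mu)$ converges in law to a centered Gaussian $\mathcal N(0,\sigma_\mu^2)$; $\sigma_\mu^2\ge 0$ denotes this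 variance. The limit defining $\Lambda$ exists in $(-\infty,+\infty]$. *)

(* Defs.v *)
From HB Require Import structures.
From mathcomp Require Import all_boot all_order all_algebra.
From mathcomp Require Import all_classical all_reals all_analysis.
Set Implicit Arguments. Unset Strict Implicit. Unset Printing Implicit Defensive.
Import Order.TTheory GRing.Theory Num.Theory.
Local Open Scope classical_set_scope.
Local Open Scope ring_scope.

Definition is_metric {R : realType} {X : Type} (d : X -> X -> R) : Prop :=
  (forall x y, 0 <= d x y) /\ (forall x y, d x y = 0 <-> x = y) /\
  (forall x y, d x y = d y x) /\ (forall x y z, d x z <= d x y + d y z).

Definition geodesic_space {R : realType} {X : Type} (d : X -> X -> R) : Prop :=
  forall x y : X, exists gam : R -> X,
    gam 0 = x /\ gam (d x y) = y /\
    forall s t, 0 <= s <= d x y -> 0 <= t <= d x y ->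
      d (gam s) (gam t) = `|s - t|.

Definition gromov_product {R : realType} {X : Type} (d : X -> X -> R)
  (o x y : X) : R := (d x o + d y o - d x y) / 2.

Definition gromov_hyperbolic {R : realType} {X : Type} (d : X -> X -> R) : Prop :=
  exists delta : R, 0 <= delta /\
    forall x y z o : X,
      Num.min (gromov_product d o x z) (gromov_product d o z y) - delta
        <= gromov_product d o x y.

Definition is_isometry {R : realType} {X : Type} (d : X -> X -> R) (g : X -> X) : Prop :=
  bijective g /\ forall x y, d (g x) (g y) = d x y.

(* Loxodromic isometry: positive stable translation length, i.e.
   d(g^n o, o) >= c n for some c > 0 (by Fekete, lim d(g^n o,o)/n = inf_n d(g^n o,o)/n). *)
Definition loxodromic {R : realType} {X : Type} (d : X -> X -> R) (o : X) (g : X -> X) : Prop :=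
  is_isometry d g /\ exists c : R, 0 < c /\ forall n : nat, c * n%:R <= d (iter n g o) o.

Definition same_boundary_point {R : realType} {X : Type} (d : X -> X -> R) (o : X)
  (x y : nat -> X) : Prop :=
  forall M : R, exists N : nat, forall n m : nat, (N <= n)%N -> (N <= m)%N ->
    M <= gromov_product d o (x n) (y m).

(* representatives of the two boundary fixed points g^+ = lim g^n o and
   g^- = lim g^{-n} o of a loxodromic g (a sequence y with g^n (y n) = o is g^{-n} o) *)
Definition boundary_fixpoint_seq {X : Type} (o : X) (g : X -> X) (x : nat -> X) : Prop :=
  x = (fun n => iter n g o) \/ (forall n, iter n g (x n) = o).

Definition independent {R : realType} {X : Type} (d : X -> X -> R) (o : X)
  (g h : X -> X) : Prop :=
  forall x y : nat -> X, boundary_fixpoint_seq o g x -> boundary_fixpoint_seq o h y ->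
    ~ same_boundary_point d o x y.

(** * Countably supported probability measures on Isom(X):
      mu = \sum_k w k \delta_{gs k} *)

Definition count_prob {R : realType} {X : Type} (d : X -> X -> R)
  (gs : nat -> X -> X) (w : nat -> R) : Prop :=
  (forall k, is_isometry d (gs k)) /\ (forall k, 0 <= w k) /\
  (\sum_(0 <= k <oo) (w k)%:E = 1)%E.

Definition in_support_semigroup {R : realType} {X : Type}
  (gs : nat -> X -> X) (w : nat -> R) (g : X -> X) : Prop :=
  exists s : seq nat, s != [::] /\ (forall k, k \in s -> 0 < w k) /\
    g = foldr (fun k f => gs k \o f) id s.

Definition non_elementary {R : realType} {X : Type} (d : X -> X -> R) (o : X)
  (gs : nat -> X -> X) (w : nat -> R) : Prop :=
  exists g h : X -> X,
    in_support_semigroup gs w g /\ in_support_semigroup gs w h /\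
    loxodromic d o g /\ loxodromic d o h /\ independent d o g h.

Definition exp_moment {R : realType} {X : Type} (d : X -> X -> R) (o : X)
  (gs : nat -> X -> X) (w : nat -> R) : Prop :=
  exists alpha : R, 0 < alpha /\
    (\sum_(0 <= k <oo) (w k * expR (alpha * d (gs k o) o))%:E < +oo)%E.

(* K i is the index of the (i+1)-th increment X_{i+1} = gs (K i);
   the K i are i.i.d. with law w (and are random variables). *)
Definition iid_indices {dT : measure_display} {T : measurableType dT} {R : realType}
  (P : probability T R) (w : nat -> R) (K : nat -> T -> nat) : Prop :=
  (forall i k, measurable [set t | K i t = k]) /\
  forall (n : nat) (ks : nat -> nat),
    P [set t | forall i, (i < n)%N -> K i t = ks i] = (\prod_(i < n) w (ks i))%:E.

Fixpoint walk {X T : Type} (gs : nat -> X -> X) (K : nat -> T -> nat) (o : X)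
  (n : nat) (t : T) : X :=
  match n with
  | 0 => o
  | m.+1 => gs (K m t) (walk gs K o m t)
  end.

Definition gauss_expect {R : realType} (sigma2 : R) (f : R -> R) : \bar R :=
  if sigma2 == 0 then (f 0)%:E
  else (\int[lebesgue_measure]_x (f x * normal_pdf 0 (Num.sqrt sigma2) x)%:E)%E.

Definition Lambda {dT : measure_display} {T : measurableType dT} {R : realType}
  {X : Type} (d : X -> X -> R) (o : X) (gs : nat -> X -> X)
  (P : probability T R) (K : nat -> T -> nat) (lam : R) : \bar R :=
  limn (fun n : nat => ((n%:R)^-1)%:E *
     lne (\int[P]_t (expR (lam * d (walk gs K o n t) o))%:E))%E.

(* Main.v *)
(** Write [D_n = d(z_n, o)]. A ping-pong argument applied to two independent
    loxodromic elements yields four words of equal length and equal probability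
    whose orbit points, and those of their inverses, lie in pairwise distinct
    directions. Cutting a random word into blocks of that length, a block which
    avoids both the direction of a given point [y] and the direction of the rest
    of the word bounds the Gromov product of [y] with the endpoint; hence these
    Gromov products have an exponential moment, uniformly in [y] and [n].

    Consequently [E D_n] is additive up to a bounded error, say
    [n b <= E D_n <= n b + G], and a martingale argument bounds
    [phi_n(l) = E exp (l (D_n - n b))] by [exp (G |l| + c l^2 n)]. Moreover
    [phi_(k+n)(l) = phi_k(l) (phi_n(l) + O(|l|))] for all [k] as long as
    [l^2 n <= 2]. Taking [N] of order [l^-2] and iterating,
    [N (Lambda(l) - l b) = ln (phi_N(l) + O(|l|))], while the central limit theorem
    and uniform integrability give [phi_N(l) --> exp (sigma^2 / 2)]; they also
    force [b] to be the drift. *)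

Require Import Defs.
From HB Require Import structures.
From mathcomp Require Import all_boot all_order all_algebra.
From mathcomp Require Import all_classical all_reals all_analysis.
From mathcomp Require Import measurable_realfun.
From mathcomp Require Import ring lra zify.
Import Order.TTheory GRing.Theory Num.Theory.
Import numFieldNormedType.Exports.
Local Open Scope classical_set_scope.
Local Open Scope ring_scope.
Set Implicit Arguments.
Unset Strict Implicit.
Unset Printing Implicit Defensive.

(** Orders of magnitude dictate the scheme. Over a block of fixed length an error [O(|l|)] in [phi]
    would swamp the term in [l ^+ 2] that is sought; over a block of length about [l ^- 2] the
    quantity [ln phi] has order 1 and the same error is harmless. The multiplicative estimate must
    thus be uniform up to that length, which is why [phi] has to be bounded there beforehand.

    The Gromov product estimate meets a conditioning problem. A block helps only if it avoids one
    direction fixed by earlier letters and one fixed by later letters, so no single order of drawing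
    makes both events independent of the block. The two conditions are charged to two functionals,
    one averaged from the left and one from the right. Each contracts because at most one of the
    four words fails: with weight 2 for failure and 1/2 for success, four words weigh at most 7/2
    instead of 4, whereas three would gain nothing.

    Expectations are iterated sums of extended nonnegative reals, so rearranging them needs no
    summability; a centered quantity enters as a difference of two nonnegative ones. *)

(** * Expectation over words with independent letters *)

Section WordExpectation.
Context {R : realType} (w : nat -> R).
Hypothesis w_ge0 : forall k, 0 <= w k.
Local Open Scope ereal_scope.
Implicit Types (F G : seq nat -> \bar R) (f : nat -> \bar R).

Definition E1 f := \sum_(0 <= k <oo) (w k)%:E * f k.

Fixpoint Ex n F : \bar R :=
  if n is m.+1 then E1 (fun k => Ex m (fun t => F (k :: t))) else F [::].

Lemma E1_ge0 f : (forall k, 0 <= f k) -> 0 <= E1 f.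
Proof. by move=> f0; apply: nneseries_ge0 => k _ _; rewrite mule_ge0// lee_fin. Qed.

Lemma le_E1 f g : (forall k, 0 <= f k) -> (forall k, f k <= g k) -> E1 f <= E1 g.
Proof.
move=> f0 fg; apply: lee_nneseries => k _; first by rewrite mule_ge0// lee_fin.
by rewrite lee_wpmul2l// lee_fin.
Qed.

Lemma eq_E1 f g : (forall k, f k = g k) -> E1 f = E1 g.
Proof. by move=> fg; apply: eq_eseriesr => k _; rewrite fg. Qed.

Lemma E1D f g : (forall k, 0 <= f k) -> (forall k, 0 <= g k) ->
  E1 (fun k => f k + g k) = E1 f + E1 g.
Proof.
move=> f0 g0; rewrite /E1 -nneseriesD.
- by apply: eq_eseriesr => k _; rewrite ge0_muleDr.
- by move=> k _ _; rewrite mule_ge0// lee_fin.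
- by move=> k _ _; rewrite mule_ge0// lee_fin.
Qed.

Lemma E1Z c f : (0 <= c)%R -> (forall k, 0 <= f k) ->
  E1 (fun k => c%:E * f k) = c%:E * E1 f.
Proof.
move=> c0 f0; rewrite /E1 -nneseriesZl; last first.
  by move=> k _; rewrite mule_ge0// lee_fin.
by apply: eq_eseriesr => k _; rewrite muleCA.
Qed.

Lemma E1_pt x f : (forall k, 0 <= f k) -> (w x)%:E * f x <= E1 f.
Proof.
move=> f0; rewrite /E1 (@nneseriesD1 _ _ x)//.
- by rewrite leeDl// nneseries_ge0// => k _ _; rewrite mule_ge0// lee_fin.
- by move=> k _; rewrite mule_ge0// lee_fin.
Qed.

Lemma E1_indic x (c : \bar R) : 0 <= c ->
  E1 (fun k => if k == x then c else 0) = (w x)%:E * c.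
Proof.
move=> c0; rewrite /E1 (@nneseriesD1 _ _ x)//; last first.
  by move=> k _; case: eqP => _; rewrite ?mule0// mule_ge0// lee_fin.
rewrite eqxx eseries0 ?adde0// => k _ /negPf/= ->; exact: mule0.
Qed.

Lemma Ex_ge0 n F : (forall s, size s = n -> 0 <= F s) -> 0 <= Ex n F.
Proof.
elim: n F => [|n IH] F F0 /=; first exact: F0.
by apply: E1_ge0 => k; apply: IH => s sn; apply: F0; rewrite /= sn.
Qed.

Lemma le_Ex n F G : (forall s, size s = n -> 0 <= F s) ->
  (forall s, size s = n -> F s <= G s) -> Ex n F <= Ex n G.
Proof.
elim: n F G => [|n IH] F G F0 FG /=; first exact: FG.
apply: le_E1 => k.
  by apply: Ex_ge0 => s sn; apply: F0; rewrite /= sn.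
by apply: IH => s sn; [apply: F0|apply: FG]; rewrite /= sn.
Qed.

Lemma eq_Ex n F G : (forall s, size s = n -> F s = G s) -> Ex n F = Ex n G.
Proof.
elim: n F G => [|n IH] F G FG /=; first exact: FG.
by apply: eq_E1 => k; apply: IH => s sn; apply: FG; rewrite /= sn.
Qed.

Lemma ExD n F G : (forall s, 0 <= F s) -> (forall s, 0 <= G s) ->
  Ex n (fun s => F s + G s) = Ex n F + Ex n G.
Proof.
elim: n F G => [//|n IH] F G F0 G0 /=.
rewrite -E1D => [|k|k]; try by apply: Ex_ge0.
by apply: eq_E1 => k; apply: IH.
Qed.

Lemma ExZ n c F : (0 <= c)%R -> (forall s, 0 <= F s) ->
  Ex n (fun s => c%:E * F s) = c%:E * Ex n F.
Proof.
elim: n F => [//|n IH] F c0 F0 /=.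
rewrite -E1Z// => [|k]; last by apply: Ex_ge0.
by apply: eq_E1 => k; apply: IH.
Qed.

Lemma Ex_cat n m F : Ex (n + m) F = Ex n (fun s => Ex m (fun t => F (s ++ t))).
Proof. by elim: n F => [//|n IH] F; rewrite addSn /=; apply: eq_E1 => k; apply: IH. Qed.

Lemma Ex_sum (I : Type) (r : seq I) n (F : I -> seq nat -> \bar R) :
  (forall i s, 0 <= F i s) ->
  Ex n (fun s => \sum_(i <- r) F i s) = \sum_(i <- r) Ex n (F i).
Proof.
move=> F0; elim: r => [|i r IH].
  rewrite big_nil (@eq_Ex _ _ (fun s => 0%:E * 0)).
    by rewrite ExZ// mul0e.
  by move=> s _; rewrite big_nil mul0e.
rewrite big_cons -IH -ExD//; last by move=> s; apply: sume_ge0.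
by apply: eq_Ex => s _; rewrite big_cons.
Qed.

Lemma Ex_indic c (x : \bar R) : 0 <= x ->
  Ex (size c) (fun s => if s == c then x else 0) = (\prod_(k <- c) w k)%:E * x.
Proof.
move=> x0; elim: c => [|k c IH] /=; first by rewrite big_nil mul1e.
rewrite big_cons EFinM -muleA -IH -E1_indic; last first.
  by apply: Ex_ge0 => s _; case: ifP.
apply: eq_E1 => j; case: eqVneq => [->|jk].
  by apply: eq_Ex => s _; rewrite eqseq_cons eqxx.
rewrite (@eq_Ex _ _ (fun=> 0%:E * 0)) ?ExZ ?mul0e// => s _.
by rewrite eqseq_cons (negPf jk).
Qed.

Lemma E1_exchange (a : nat -> nat -> \bar R) : (forall k j, 0 <= a k j) ->
  E1 (fun k => E1 (a k)) = E1 (fun j => E1 (fun k => a k j)).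
Proof.
move=> a0; rewrite /E1.
have w0 k x : 0 <= x -> 0 <= (w k)%:E * x by move=> x0; rewrite mule_ge0// lee_fin.
rewrite (eq_eseriesr (g := fun k => \sum_(0 <= j <oo) (w k)%:E * ((w j)%:E * a k j))).
  2: by move=> k _; rewrite nneseriesZl// => j _; exact: w0.
rewrite nneseries_interchange; last by move=> k j; rewrite !w0.
apply: eq_eseriesr => j _; rewrite -nneseriesZl//; last by move=> k _; exact: w0.
by apply: eq_eseriesr => k _; rewrite muleCA.
Qed.

Lemma Ex_E1_exchange n (a : nat -> seq nat -> \bar R) : (forall k s, 0 <= a k s) ->
  E1 (fun k => Ex n (a k)) = Ex n (fun s => E1 (fun k => a k s)).
Proof.
elim: n a => [//|n IH] a a0 /=; rewrite E1_exchange.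
  by apply: eq_E1 => j; rewrite IH.
by move=> k j; apply: Ex_ge0.
Qed.

(** Tonelli, in the form that freezes the suffix and averages the prefix inside; this is the order
    needed when a condition on a block depends on the letters after it. *)
Lemma Ex_catr n m F : (forall s, 0 <= F s) ->
  Ex (n + m) F = Ex m (fun t => Ex n (fun s => F (s ++ t))).
Proof.
elim: n F => [//|n IH] F F0; rewrite addSn /= -Ex_E1_exchange.
  by apply: eq_E1 => k; rewrite IH.
by move=> k s; apply: Ex_ge0.
Qed.

Hypothesis w_sum1 : \sum_(0 <= k <oo) (w k)%:E = 1.

Lemma pos_weight : exists k, (0 < w k)%R.
Proof.
apply: contrapT => /forallNP wN.
have : \sum_(0 <= k <oo) (w k)%:E = 0.
  apply: eseries0 => k _ _; congr _%:E; apply/eqP; rewrite eq_le w_ge0 andbT.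
  by rewrite leNgt; apply/negP/wN.
by rewrite w_sum1 => /eqP; rewrite onee_eq0.
Qed.

Lemma E1_cst (c : \bar R) : 0 <= c -> E1 (fun=> c) = c.
Proof.
case: c => [c| |//] c0.
  rewrite /E1 (eq_eseriesr (g := fun k => c%:E * (w k)%:E)).
    by rewrite nneseriesZl ?w_sum1 ?mule1// => k _; rewrite lee_fin.
  by move=> k _; rewrite muleC.
(* As [0 * +oo = 0], a letter of positive weight is needed to make the sum infinite. *)
apply/eqP; rewrite -leye_eq.
have [k wk] := pos_weight.
by have := @E1_pt k (fun=> +oo) (fun=> c0); rewrite gt0_muley// lte_fin.
Qed.

Lemma Ex_cst n (c : \bar R) : 0 <= c -> Ex n (fun=> c) = c.
Proof. by move=> c0; elim: n => //= n IH; rewrite IH E1_cst. Qed.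

Lemma Ex_prod n (u : nat -> R) (m : R) : (forall k, 0 <= u k)%R ->
  E1 (fun k => (u k)%:E) = m%:E ->
  Ex n (fun s => (\prod_(k <- s) u k)%:E) = (m ^+ n)%:E.
Proof.
move=> u0 um; elim: n => [|n IH] /=; first by rewrite big_nil expr0.
rewrite (eq_E1 (g := fun k => (m ^+ n)%:E * (u k)%:E)).
  rewrite E1Z ?um ?exprSr// exprn_ge0// -lee_fin -um.
  by apply: E1_ge0 => k; rewrite lee_fin.
move=> k; rewrite muleC -IH -ExZ//.
  by apply: eq_Ex => s _; rewrite big_cons EFinM.
by move=> s; rewrite lee_fin prodr_ge0.
Qed.

End WordExpectation.

(** * Hyperbolic inequalities and orbits of loxodromic isometries *)

Lemma iter_cancel (T : Type) (f g : T -> T) n : cancel f g ->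
  cancel (iter n f) (iter n g).
Proof. by move=> fK; elim: n => [//|n IH] x; rewrite iterSr iterS fK IH. Qed.

Section Hyperbolic.
Context {R : realType} {X : Type} (d : X -> X -> R) (o : X) (delta : R).
Hypothesis dm : is_metric d.
Hypothesis delta_ge0 : 0 <= delta.
Hypothesis hyp : forall x y z p : X,
  Num.min (gromov_product d p x z) (gromov_product d p z y) - delta
    <= gromov_product d p x y.

Local Notation gp := (gromov_product d o).
Local Notation isometric g := (forall x y, d (g x) (g y) = d x y).

Lemma dist_ge0 x y : 0 <= d x y. Proof. by case: dm. Qed.
Lemma distxx x : d x x = 0. Proof. by case: dm => _ [/(_ x x)[_ ->]]. Qed.
Lemma distC x y : d x y = d y x. Proof. by case: dm => _ [_ []]. Qed.
Lemma dist_triangle y x z : d x z <= d x y + d y z.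
Proof. by case: dm => _ [_ []]. Qed.

Lemma gpC x y : gp x y = gp y x.
Proof. by rewrite /gromov_product (distC x y); lra. Qed.

Lemma gp_ge0 x y : 0 <= gp x y.
Proof.
by rewrite /gromov_product; have := dist_triangle o x y; rewrite (distC o); lra.
Qed.

Lemma gp_lel x y : gp x y <= d x o.
Proof. by rewrite /gromov_product; have := dist_triangle x y o; rewrite (distC y x); lra. Qed.

Lemma gp_ler x y : gp x y <= d y o. Proof. by rewrite gpC gp_lel. Qed.

Lemma gp_hyp z x y : gp x z <= gp x y + delta \/ gp z y <= gp x y + delta.
Proof. by have := hyp x y z o; rewrite lerBlDr ge_min => /orP. Qed.

Lemma four_point x y z t :
  d x z + d y t <= d x y + d z t + 2 * delta \/
  d x z + d y t <= d x t + d y z + 2 * delta.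
Proof.
have := hyp y t z x; rewrite lerBlDr ge_min /gromov_product.
rewrite (distC y x) (distC z x) (distC t x) => /orP[]; [right|left]; lra.
Qed.

(** Avoiding the direction of [gi o] amounts to [g z] staying in the direction of [g o]. Every
    ping-pong step below rests on this identity. *)
Lemma gp_iso_orbit (g gi : X -> X) z : cancel gi g -> isometric g ->
  gp (g o) (g z) = d (g o) o - gp (gi o) z.
Proof.
move=> gK gd; have := gd z (gi o); have := gd (gi o) o; rewrite !gK.
rewrite /gromov_product gd (distC o (g o)) (distC o z) (distC z (gi o)).
by lra.
Qed.

Lemma isometric_iter g n : isometric g -> isometric (iter n g).
Proof. by move=> gd; elim: n => [//|n IH] x y; rewrite !iterS gd IH. Qed.

Lemma isometric_inv g gi : cancel gi g -> isometric g -> isometric gi.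
Proof. by move=> gK gd x y; rewrite -gd !gK. Qed.

Lemma dist_inv g gi : cancel gi g -> isometric g -> d (gi o) o = d (g o) o.
Proof. by move=> gK gd; rewrite -gd gK distC. Qed.

Lemma dist_iter g n m : isometric g -> (n <= m)%N ->
  d (iter n g o) (iter m g o) = d (iter (m - n) g o) o.
Proof.
by move=> gd nm; rewrite -{1}(subnKC nm) iterD isometric_iter// distC.
Qed.

Lemma dist_iter_le g n : isometric g -> d (iter n g o) o <= n%:R * d (g o) o.
Proof.
move=> gd; elim: n => [|n IH]; first by rewrite /= distxx mul0r.
have := dist_triangle (g o) (iter n.+1 g o) o.
by rewrite iterS gd -natr1; lra.
Qed.

Section Loxodromic.
Variable g : X -> X.
Hypothesis gd : isometric g.
Local Notation a n := (d (iter n g o) o).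

Lemma iter_subadd n m : a (n + m)%N <= a n + a m.
Proof.
have := dist_triangle (iter n g o) (iter (n + m) g o) o.
by rewrite iterD isometric_iter//; lra.
Qed.

(* If the orbit moves away fast enough on the scale [p], the four-point
   inequality propagates this to every multiple of [p]. *)
Lemma almost_additive_multiples p (L := 6 * delta + 1) : a p + L <= a (2 * p)%N ->
  forall A B, a (A * p)%N + a (B * p)%N <= a ((A + B) * p)%N + 2 * a p + 2 * delta.
Proof.
move=> ap; pose b k := a (k * p)%N.
have dist_b i j : (i <= j)%N -> d (iter (i * p) g o) (iter (j * p) g o) = b (j - i)%N.
  by move=> ij; rewrite dist_iter ?leq_mul2r ?ij ?orbT// -mulnBl.
have b0 : b 0%N = 0 by rewrite /b mul0n distxx.
have b1 : b 1%N = a p by rewrite /b mul1n.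
(* The slack [L] refutes the alternative of the four-point inequality in which the orbit turns back;
   the other alternative passes the increment on. *)
have step k : b k + L - 2 * delta <= b k.+1.
  elim: k => [|k IH].
    rewrite b0 b1; have := iter_subadd p p; rewrite addnn -mul2n.
    by move: ap; rewrite /L; have := delta_ge0; lra.
  have := four_point o (iter (k * p) g o) (iter (k.+1 * p) g o) (iter (k.+2 * p) g o).
  rewrite !dist_b ?leq_addr//; try lia.
  rewrite !(distC o) -/(b k) -/(b k.+1) -/(b k.+2).
  rewrite !subSnn (_ : (k.+2 - k = 2)%N); last lia.
  move: ap; rewrite -/(b 2%N) -b1; have := delta_ge0; rewrite /L in IH *.
  by move=> ? ? [?|?]; lra.
move=> A B; rewrite -/(b A) -/(b B) -/(b (A + B)%N) -b1.
have := four_point o (iter (A * p) g o) (iter (A.+1 * p) g o) (iter ((A + B).+1 * p) g o).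
rewrite !dist_b; try lia.
rewrite !(distC o) -/(b A) -/(b A.+1) -/(b (A + B).+1).
rewrite subSnn (_ : ((A + B).+1 - A = B.+1)%N); last lia.
rewrite (_ : ((A + B).+1 - A.+1 = B)%N); last lia.
have := step A; have := step B; have := step (A + B)%N; have := delta_ge0.
have : b (A + B).+1 <= b (A + B)%N + b 1%N.
  by rewrite /b mulSn addnC mul1n iter_subadd.
by rewrite /L => ? ? ? ? ? [?|?]; lra.
Qed.

(** Otherwise each doubling of the exponent would add less than [L], and the displacement would grow
    logarithmically along powers of 2, against the linear lower bound. *)
Lemma doubling_scale c L : 0 < c -> 0 <= L -> (forall n : nat, c * n%:R <= a n) ->
  exists p, (0 < p)%N /\ a p + L <= a (2 * p)%N.
Proof.
move=> c0 L0 ca; apply: contrapT => Np.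
have grow j : a (2 ^ j)%N <= a 1%N + j%:R * L.
  elim: j => [|j IH]; first by rewrite expn0 mul0r addr0.
  rewrite expnS -natr1 leNgt; apply/negP => H; apply: Np.
  by exists (2 ^ j)%N; rewrite expn_gt0; split => //; lra.
have dist0 := dist_ge0 (iter 1 g o) o.
have [j Hj] : exists j : nat, a 1%N + j%:R * L < c * (2 ^ j)%:R.
  (* The exponent is [2 * i] because [2 ^ (2 * i)] is at least the square of [i.+1], which beats a
     bound linear in [i]. *)
  pose i := Num.bound ((a 1%N + 2 * L) / c).
  have Hi : a 1%N + 2 * L < c * i.+1%:R.
    rewrite [ltRHS]mulrC -ltr_pdivrMr//.
    have y0 : 0 <= (a 1%N + 2 * L) / c by rewrite divr_ge0 ?(ltW c0)//; lra.
    by rewrite (lt_trans (archi_boundP y0))// ltr_nat.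
  exists (2 * i)%N; have i2 : i.+1%:R <= (2 ^ i)%:R :> R by rewrite ler_nat ltn_expl.
  rewrite mulnC expnM -mulnn natrM.
  have i0 : 0 <= i%:R :> R by [].
  have : c * i.+1%:R * i.+1%:R <= c * ((2 ^ i)%:R * (2 ^ i)%:R).
    by rewrite -mulrA ler_pM2l// ler_pM.
  have : (a 1%N + 2 * L) * i.+1%:R < c * i.+1%:R * i.+1%:R by rewrite ltr_pM2r.
  by rewrite natrM -natr1; nra.
have := ca (2 ^ j)%N; have := grow j; lra.
Qed.

(** Almost additivity along multiples of a good scale [p] extends to all exponents, since rounding
    down to a multiple of [p] costs at most [p] displacements of [g]. *)
Lemma loxodromic_additive c : 0 < c -> (forall n : nat, c * n%:R <= a n) ->
  exists C, forall n m, a n + a m <= a (n + m)%N + C.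
Proof.
move=> c0 ca.
have [|p [p0 ap]] := @doubling_scale c (6 * delta + 1) c0 _ ca.
  by have := delta_ge0; lra.
have AB := almost_additive_multiples ap.
pose D := p%:R * d (g o) o.
have D0 : 0 <= D by rewrite mulr_ge0// dist_ge0.
have rem n : a n <= a (n %/ p * p)%N + D.
  rewrite {1}(divn_eq n p) (le_trans (iter_subadd _ _))// lerD2l.
  rewrite (le_trans (dist_iter_le _ gd))// ler_wpM2r ?dist_ge0// ler_nat.
  by rewrite ltnW// ltn_mod.
exists (4 * D + 2 * a p + 2 * delta) => n m.
have := rem n; have := rem m; have := AB (n %/ p)%N (m %/ p)%N.
have : a ((n %/ p + m %/ p) * p)%N <= a (n + m)%N + 2 * D.
  have := dist_triangle (iter (n + m) g o) (iter ((n %/ p + m %/ p) * p) g o) o.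
  rewrite dist_iter//; last by rewrite mulnDl leq_add// leq_trunc_div.
  have -> : (n + m - (n %/ p + m %/ p) * p = n %% p + m %% p)%N.
    by rewrite {1}(divn_eq n p) {1}(divn_eq m p) mulnDl; lia.
  have H k : a (k %% p)%N <= D.
    rewrite (le_trans (dist_iter_le _ gd))// ler_wpM2r ?dist_ge0// ler_nat.
    by rewrite ltnW// ltn_mod.
  by have := iter_subadd (n %% p) (m %% p); have := H n; have := H m; lra.
lra.
Qed.

End Loxodromic.
End Hyperbolic.

(** * Ping-pong for two independent loxodromic isometries *)

Section Schottky.
Context {R : realType} {X : Type} (d : X -> X -> R) (o : X) (delta : R).
Hypothesis dm : is_metric d.
Hypothesis delta_ge0 : 0 <= delta.
Hypothesis hyp : forall x y z p : X,
  Num.min (gromov_product d p x z) (gromov_product d p z y) - delta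
    <= gromov_product d p x y.

Local Notation gp := (gromov_product d o).
Local Notation isometric g := (forall x y, d (g x) (g y) = d x y).

(** Equivalently, the Gromov product of [o] and [x m] seen from [x n] is at most [C / 2]: the
    sequence leaves [o] without backtracking, up to a constant. *)
Definition quasi_ray (x : nat -> X) := exists C, forall n m, (n <= m)%N ->
  d (x n) o + d (x n) (x m) <= d (x m) o + C.

Lemma loxodromic_quasi_ray g gi : cancel gi g -> loxodromic d o g ->
  quasi_ray (fun n => iter n g o) /\ quasi_ray (fun n => iter n gi o).
Proof.
move=> gK [[_ gd] [c [c0 ca]]].
have [C HC] := loxodromic_additive dm delta_ge0 hyp gd c0 ca.
have gid := isometric_inv gK gd.
have di n : d (iter n gi o) o = d (iter n g o) o.
  by apply: (dist_inv o dm); [exact: iter_cancel|exact: isometric_iter].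
split; exists C => n m nm; rewrite dist_iter// ?di; have := HC n (m - n)%N;
  by rewrite subnKC.
Qed.

(** The absence of a common boundary point yields only some pair with small product beyond any given
    index. Taken beyond [i] and [j], it controls that pair by two uses of hyperbolicity, because a
    point of a quasi-ray lies in the direction of its later points. *)
Lemma quasi_rays_gp_bounded x y : quasi_ray x -> quasi_ray y ->
  ~ same_boundary_point d o x y -> exists C, forall n m, gp (x n) (y m) <= C.
Proof.
move=> [C xC] [C' yC] /existsNP[M /forallNP sM].
exists (Num.max (M + 2 * delta) (Num.max (M + 2 * delta + C / 2) (M + 2 * delta + C' / 2))).
move=> i j; rewrite !le_max.
have /existsNP[n /existsNP[m]] := sM (maxn i j).
move/not_implyP => [+ /not_implyP[+ /negP]]; rewrite !geq_max -ltNge.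
move=> /andP[ni nj] /andP[mi mj] xyM.
have d0 := delta_ge0; have xi := gp_lel o dm (x i) (y j); have yj := gp_ler o dm (x i) (y j).
have := xC _ _ ni; have := yC _ _ mj.
have [H1|H1] := gp_hyp o hyp (x i) (x n) (y m).
  move=> _ H2; apply/orP; right; apply/orP; left; move: H1.
  by rewrite /gromov_product in xi xyM *; rewrite (distC dm (x n) (x i)); lra.
have [H2|H2] := gp_hyp o hyp (y j) (x i) (y m).
  by move=> *; apply/orP; left; lra.
move=> H3 _; apply/orP; right; apply/orP; right; move: H2.
by rewrite /gromov_product in H1 yj xyM *; lra.
Qed.

Lemma gp_translate (g : X -> X) y z : isometric g ->
  gp (g y) (g z) <= d (g o) o + gp y z.
Proof.
move=> gd; rewrite /gromov_product gd.
have := dist_triangle dm (g o) (g y) o; have := dist_triangle dm (g o) (g z) o.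
by rewrite !gd; lra.
Qed.

(** Once the common prefix is removed, one point starts with a power of [h] and the other with a
    power of [g]; by [gp_iso_orbit] each keeps the direction of its first power, and these
    directions diverge. The bound does not involve [M], which can therefore be chosen last. *)
Lemma fork (g gi h hi : X -> X) (C0 : R) (N M i j b b' : nat) :
  cancel g gi -> cancel gi g -> isometric g ->
  cancel hi h -> isometric h ->
  (forall n m, gp (iter n h o) (iter m g o) <= C0) ->
  (forall n m, gp (iter n h o) (iter m gi o) <= C0) ->
  (forall n m, gp (iter n hi o) (iter m g o) <= C0) ->
  (forall k, (0 < k)%N -> 2 * C0 + 4 * delta < d (iter (k * N) g o) o) ->
  2 * C0 + 4 * delta < d (iter M h o) o ->
  (i < j)%N ->
  gp (iter (i * N) g (iter M h (iter b g o)))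
     (iter (j * N) g (iter M h (iter b' g o)))
  <= (i * N)%:R * d (g o) o + C0 + 2 * delta.
Proof.
move=> gK giK gd hK hd hg hgi hig gN hM ij.
have gid := isometric_inv giK gd.
rewrite -(subnKC (ltnW ij)) mulnDl iterD.
set v := iter M h (iter b g o); set v' := iter M h (iter b' g o).
have -> : forall x y z : R, x + y + z = x + (y + z) by move=> *; ring.
apply: (le_trans (gp_translate _ _ (isometric_iter _ gd))).
apply: lerD; first exact: dist_iter_le.
set k := ((j - i) * N)%N.
have far c : d (iter M h o) o - C0 <= gp (iter M h o) (iter M h (iter c g o)).
  rewrite (gp_iso_orbit o dm _ (iter_cancel _ hK) (isometric_iter _ hd)).
  by rewrite lerD2l lerN2 hig.
have near c z : gp (iter M h o) z <= C0 ->
    gp (iter M h (iter c g o)) z <= C0 + delta.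
  move=> zC; have := far c; have := gp_hyp o hyp (iter M h (iter c g o)) (iter M h o) z.
  by have := delta_ge0; move=> ? [?|?] ?; lra.
have vk : gp v (iter k g o) <= C0 + delta by apply: near.
have v'k : d (iter k g o) o - (C0 + delta) <= gp (iter k g o) (iter k g v').
  rewrite (gp_iso_orbit o dm _ (iter_cancel _ giK) (isometric_iter _ gd)).
  by rewrite lerD2l lerN2 gpC// near.
have := gN (j - i)%N; rewrite subn_gt0 => /(_ ij); rewrite -/k.
have := gp_hyp o hyp (iter k g v') v (iter k g o).
rewrite (gpC o dm (iter k g v') (iter k g o)).
by have := delta_ge0; move=> ? [?|?] ?; lra.
Qed.

(** The elements use the same total powers of [g] and [h], so that words spelling them have equal
    length and probability. Their leading powers of [g] differ, and so do those of the inverses,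
    where [5 - i] replaces [i]; hence [fork] applies on both sides. Constants are chosen in the
    order [N], [C], [M], so a large [M] makes the displacement exceed [2 * C + kappa]. *)
Lemma schottky g gi h hi (kappa : R) :
  cancel g gi -> cancel gi g -> cancel h hi -> cancel hi h ->
  loxodromic d o g -> loxodromic d o h -> independent d o g h ->
  exists N M C,
    let u i x := iter (i * N) g (iter M h (iter ((5 - i) * N) g x)) in
    let ui i x := iter ((5 - i) * N) gi (iter M hi (iter (i * N) gi x)) in
    [/\ 0 <= C,
      forall i j, (i < j < 5)%N -> gp (u i o) (u j o) <= C,
      forall i j, (i < j < 5)%N -> gp (ui i o) (ui j o) <= C &
      forall i, (i < 5)%N -> 2 * C + kappa < d (u i o) o].
Proof.
move=> gK giK hK hiK gl hl gh.
have [gq giq] := loxodromic_quasi_ray giK gl.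
have [hq hiq] := loxodromic_quasi_ray hiK hl.
have gN : boundary_fixpoint_seq o g (fun n => iter n gi o).
  by right => n; rewrite iter_cancel.
have hN : boundary_fixpoint_seq o h (fun n => iter n hi o).
  by right => n; rewrite iter_cancel.
have gP : boundary_fixpoint_seq o g (fun n => iter n g o) by left.
have hP : boundary_fixpoint_seq o h (fun n => iter n h o) by left.
have [C1 H1] := quasi_rays_gp_bounded gq hq (gh _ _ gP hP).
have [C2 H2] := quasi_rays_gp_bounded gq hiq (gh _ _ gP hN).
have [C3 H3] := quasi_rays_gp_bounded giq hq (gh _ _ gN hP).
have [C4 H4] := quasi_rays_gp_bounded giq hiq (gh _ _ gN hN).
have [[_ gd] [c [c0 ca]]] := gl; have [[_ hd] [c' [c'0 ca']]] := hl.
have gid := isometric_inv giK gd; have hid := isometric_inv hiK hd.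
pose C0 := Num.max (Num.max C1 C2) (Num.max C3 C4).
have C0P x : [|| x <= C1, x <= C2, x <= C3 | x <= C4] -> x <= C0.
  by rewrite !le_max => /or4P[]->; rewrite ?orbT.
have C00 : 0 <= C0.
  by apply: le_trans (C0P _ _); [exact: (gp_ge0 o dm (iter 0 g o) (iter 0 h o))|rewrite H1].
have [N HN] : exists N : nat, 2 * C0 + 4 * delta < c * N%:R.
  exists (Num.bound ((2 * C0 + 4 * delta) / c)).
  rewrite [ltRHS]mulrC -ltr_pdivrMr// archi_boundP// divr_ge0 ?(ltW c0)//.
  by have := delta_ge0; lra.
have gN' k : (0 < k)%N -> 2 * C0 + 4 * delta < d (iter (k * N) g o) o.
  move=> k0; rewrite (lt_le_trans HN)// (le_trans _ (ca _))// ler_pM2l// ler_nat.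
  by rewrite leq_pmull.
pose D := (5 * N)%:R * d (g o) o.
have D0 : 0 <= D by rewrite mulr_ge0// dist_ge0.
pose C := D + C0 + 2 * delta.
have C_ge0 : 0 <= C by rewrite /C; have := delta_ge0; lra.
have [M HM] : exists M : nat, 2 * C + D + `|kappa| + 2 * C0 + 4 * delta < c' * M%:R.
  exists (Num.bound ((2 * C + D + `|kappa| + 2 * C0 + 4 * delta) / c')).
  rewrite [ltRHS]mulrC -ltr_pdivrMr// archi_boundP// divr_ge0 ?(ltW c'0)//.
  by have := delta_ge0; have := normr_ge0 kappa; lra.
have {}HM := lt_le_trans HM (ca' M).
have hM' : 2 * C0 + 4 * delta < d (iter M h o) o.
  by apply: le_lt_trans HM; have := normr_ge0 kappa; lra.
have di n : d (iter n gi o) o = d (iter n g o) o.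
  by apply: (dist_inv o dm); [exact: iter_cancel|exact: isometric_iter].
have dhi n : d (iter n hi o) o = d (iter n h o) o.
  by apply: (dist_inv o dm); [exact: iter_cancel|exact: isometric_iter].
exists N, M, C; split=> //.
- move=> i j /andP[ij j5].
  apply: (le_trans (fork _ _ gK giK gd hiK hd _ _ _ gN' hM' ij)) => [n m|n m|n m|].
  + by apply: C0P; rewrite gpC// H1.
  + by apply: C0P; rewrite gpC// H3 !orbT.
  + by apply: C0P; rewrite gpC// H2 !orbT.
  + rewrite /C -!addrA lerD2r ler_wpM2r ?dist_ge0// ler_nat leq_mul2r.
    by rewrite ltnW ?orbT// (leq_trans ij)// ltnW.
- move=> i j /andP[ij j5]; rewrite gpC//.
  have ji : (5 - j < 5 - i)%N by lia.
  apply: (le_trans (fork _ _ giK gK gid hK hid _ _ _ _ _ ji)) => [n m|n m|n m|k k0||].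
  + by apply: C0P; rewrite gpC// H4 !orbT.
  + by apply: C0P; rewrite gpC// H2 !orbT.
  + by apply: C0P; rewrite gpC// H3 !orbT.
  + by rewrite di gN'.
  + by rewrite dhi.
  + rewrite (dist_inv o dm giK gd) /C -!addrA lerD2r ler_wpM2r ?dist_ge0//.
    by rewrite ler_nat leq_mul2r leq_subr orbT.
- move=> i i5.
  set v := iter ((5 - i) * N) g o; set u := iter M h v.
  have h1 := dist_triangle dm u (iter M h o) o.
  have h2 : d (iter M h o) u = d v o by rewrite (isometric_iter _ hd) (distC dm).
  have h3 : d u o = d (iter (i * N) g u) (iter (i * N) g o).
    by rewrite (isometric_iter _ gd).
  have h4 := dist_triangle dm o (iter (i * N) g u) (iter (i * N) g o).
  rewrite (distC dm o) in h4.
  have h5 := dist_iter_le o dm (i * N) gd.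
  have h6 : d v o <= _ := dist_iter_le o dm ((5 - i) * N) gd.
  have : (i * N)%:R * d (g o) o + ((5 - i) * N)%:R * d (g o) o = D.
    by rewrite -mulrDl -natrD -mulnDl subnKC// ltnW.
  by move: HM; have := ler_norm kappa; have := delta_ge0; lra.
Qed.
End Schottky.

(** * Words, their action and the Schottky words *)

Section Words.
Context {R : realType} {X : Type} (d : X -> X -> R) (o : X).
Context (gs gi : nat -> X -> X) (w : nat -> R).
Hypothesis dm : is_metric d.
Hypothesis gsd : forall k x y, d (gs k x) (gs k y) = d x y.
Hypothesis gsK : forall k, cancel (gs k) (gi k).
Hypothesis giK : forall k, cancel (gi k) (gs k).
Implicit Types s t : seq nat.

Definition act s (x : X) := foldr gs x s.
Definition actV s (x : X) := foldl (fun x k => gi k x) x s.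
Definition weight s := \prod_(k <- s) w k.
Definition total_step s := \sum_(k <- s) d (gs k o) o.

Lemma act_cat s t x : act (s ++ t) x = act s (act t x).
Proof. exact: foldr_cat. Qed.

Lemma actK s : cancel (act s) (actV s).
Proof. by elim: s => [//|k s IH] x /=; rewrite gsK IH. Qed.

Lemma actVK s : cancel (actV s) (act s).
Proof. by elim: s => [//|k s IH] x /=; rewrite IH giK. Qed.

Lemma isometric_act s x y : d (act s x) (act s y) = d x y.
Proof. by elim: s => [//|k s IH] /=; rewrite gsd IH. Qed.

Lemma dist_act_le s : d (act s o) o <= total_step s.
Proof.
rewrite /total_step; elim: s => [|k s IH] /=; first by rewrite big_nil (distxx dm).
rewrite big_cons; have := dist_triangle dm (gs k o) (gs k (act s o)) o.
by rewrite gsd; lra.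
Qed.

Lemma act_flatten n s x : act (flatten (nseq n s)) x = iter n (act s) x.
Proof. by elim: n => [//|n IH] /=; rewrite act_cat IH. Qed.

Lemma actV_cat s t x : actV (s ++ t) x = actV t (actV s x).
Proof. exact: foldl_cat. Qed.

Lemma actV_flatten n s x : actV (flatten (nseq n s)) x = iter n (actV s) x.
Proof. by elim: n x => [//|n IH] x; rewrite iterSr /= actV_cat IH. Qed.

Lemma weight_cat s t : weight (s ++ t) = weight s * weight t.
Proof. by rewrite /weight big_cat. Qed.

Lemma weight_flatten n s : weight (flatten (nseq n s)) = weight s ^+ n.
Proof.
elim: n => [|n IH]; first by rewrite /weight big_nil.
by rewrite /= weight_cat IH exprS.
Qed.

Lemma size_flatten_nseq (n : nat) s : size (flatten (nseq n s)) = (n * size s)%N.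
Proof. by elim: n => [//|n IH] /=; rewrite size_cat IH mulSn. Qed.

Lemma weight_gt0 s : (forall k, k \in s -> 0 < w k) -> 0 < weight s.
Proof. by move=> ws; rewrite /weight big_seq; apply: prodr_gt0. Qed.

Lemma in_support_semigroup_act g : in_support_semigroup gs w g ->
  exists s, 0 < weight s /\ g = act s.
Proof.
move=> [s [_ [sw ->]]]; exists s; split; first exact: weight_gt0.
by apply/funext => x; elim: s {sw} => [//|k s /= ->].
Qed.

Lemma schottky_words delta : 0 <= delta ->
  (forall x y z p : X,
    Num.min (gromov_product d p x z) (gromov_product d p z y) - delta
    <= gromov_product d p x y) ->
  non_elementary d o gs w -> forall kappa,
  exists (S : 'I_4 -> seq nat) (r : nat) (beta C : R),
  [/\ 0 < beta, 0 <= C,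
    forall i, [/\ size (S i) = r, weight (S i) = beta &
               2 * C + kappa < d (act (S i) o) o],
    forall i j, i != j -> gromov_product d o (act (S i) o) (act (S j) o) <= C &
    forall i j, i != j -> gromov_product d o (actV (S i) o) (actV (S j) o) <= C].
Proof.
move=> delta0 hyp [g [h [gw [hw [gl [hl gh]]]]]] kappa.
have [sg [wg eg]] := in_support_semigroup_act gw.
have [sh [wh eh]] := in_support_semigroup_act hw; subst g h.
have [N [M [C [C0 uC uiC uD]]]] :=
  schottky dm delta0 hyp kappa (@actK sg) (@actVK sg) (@actK sh) (@actVK sh) gl hl gh.
pose S (i : 'I_4) := flatten (nseq (i * N) sg) ++ flatten (nseq M sh) ++
  flatten (nseq ((5 - i) * N) sg).
have i5 (i : 'I_4) : (i < 5)%N by rewrite (leq_trans (ltn_ord i)).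
have lr (i : 'I_4) : (i * N + (5 - i) * N = 5 * N)%N.
  by rewrite -mulnDl subnKC// ltnW.
have Sact i x : act (S i) x =
    iter (i * N) (act sg) (iter M (act sh) (iter ((5 - i) * N) (act sg) x)).
  by rewrite !act_cat !act_flatten.
have SactV i x : actV (S i) x =
    iter ((5 - i) * N) (actV sg) (iter M (actV sh) (iter (i * N) (actV sg) x)).
  by rewrite !actV_cat !actV_flatten.
exists S, (5 * N * size sg + M * size sh)%N, (weight sg ^+ (5 * N) * weight sh ^+ M), C.
split => //.
- by rewrite mulr_gt0// exprn_gt0.
- move=> i; split.
  + by rewrite !size_cat !size_flatten_nseq -(lr i); ring.
  + by rewrite !weight_cat !weight_flatten -(lr i) exprD; ring.
  + by rewrite Sact uD.
- move=> i j; rewrite !Sact neq_ltn => /orP[ij|ji]; first by rewrite uC ?ij ?i5.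
  by rewrite gpC// uC ?ji ?i5.
- move=> i j; rewrite !SactV neq_ltn => /orP[ij|ji]; first by rewrite uiC ?ij ?i5.
  by rewrite gpC// uiC ?ji ?i5.
Qed.

End Words.

(** * Exponential moments with a small parameter *)

Section ExpBounds.
Context {R : realType}.
Implicit Types a t x : R.

Lemma expR_tangent x z : expR z * (1 + x - z) <= expR x.
Proof.
have -> : expR x = expR z * expR (x - z) by rewrite -expRD; congr expR; ring.
by rewrite ler_pM2l ?expR_gt0// -addrA expR_ge1Dx.
Qed.

Lemma expR_scale_le t x : 0 <= t <= 1 -> expR (t * x) <= 1 + t * expR x.
Proof.
move=> /andP[t0 t1].
have h1 : t * (expR (t * x) * (1 + x - t * x)) <= t * expR x.
  by rewrite ler_wpM2l// expR_tangent.
have h2 : (1 - t) * (expR (t * x) * (1 + 0 - t * x)) <= (1 - t) * 1.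
  by rewrite ler_wpM2l ?subr_ge0// -[leRHS]expR0 expR_tangent.
have : t * (expR (t * x) * (1 + x - t * x)) +
  (1 - t) * (expR (t * x) * (1 + 0 - t * x)) = expR (t * x) by ring.
by lra.
Qed.
End ExpBounds.

Section Moments.
Context {R : realType} (w : nat -> R) (u : nat -> R) (alpha m : R).
Hypothesis w_ge0 : forall k, 0 <= w k.
Hypothesis w_sum1 : (\sum_(0 <= k <oo) (w k)%:E = 1)%E.
Hypothesis u_ge0 : forall k, 0 <= u k.
Hypothesis alpha_gt0 : 0 < alpha.
Hypothesis um : (E1 w (fun k => (expR (alpha * u k))%:E) = m%:E)%E.

Lemma moment_ge1 : 1 <= m.
Proof.
rewrite -lee_fin -um -{1}(E1_cst w_ge0 w_sum1 lee01).
apply: le_E1 => // k; rewrite lee_fin -expR0 ler_expR mulr_ge0// ltW//.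
Qed.

(** A small exponent brings the moment of one step close to 1, so that the contraction over a block
    survives the factor [expR (a * step c)]. *)
Lemma small_moment t : 0 <= t <= 1 ->
  exists2 mt, (E1 w (fun k => (expR (t * alpha * u k))%:E) = mt%:E)%E &
     1 <= mt <= 1 + t * m.
Proof.
move=> /andP[t0 t1].
have up : (E1 w (fun k => (expR (t * alpha * u k))%:E) <= (1 + t * m)%:E)%E.
  have e0 k : (0 <= (expR (alpha * u k))%:E)%E by rewrite lee_fin expR_ge0.
  rewrite EFinD EFinM -um -(E1_cst w_ge0 w_sum1 lee01) -E1Z// -E1D//.
  2: by move=> k; rewrite mule_ge0// lee_fin.
  apply: le_E1 => // k; rewrite -EFinM -EFinD lee_fin.
  by rewrite -mulrA expR_scale_le ?t0.
have lo : (1 <= E1 w (fun k => (expR (t * alpha * u k))%:E))%E.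
  rewrite -[leLHS](E1_cst w_ge0 w_sum1 lee01).
  by apply: le_E1 => // k; rewrite lee_fin -expR0 ler_expR !mulr_ge0// ltW.
have fin : E1 w (fun k => (expR (t * alpha * u k))%:E) \is a fin_num.
  by rewrite ge0_fin_numE ?(le_lt_trans up (ltry _))// (le_trans _ lo).
exists (fine (E1 w (fun k => (expR (t * alpha * u k))%:E))); first by rewrite fineK.
by rewrite -!lee_fin fineK// lo up.
Qed.
End Moments.

(** * Exponential moments of Gromov products *)

Section GromovProductTail.
Context {R : realType} {X : Type} (d : X -> X -> R) (o : X) (delta : R).
Context (gs gi : nat -> X -> X) (w : nat -> R).
Hypothesis dm : is_metric d.
Hypothesis delta_ge0 : 0 <= delta.
Hypothesis hyp : forall x y z p : X,
  Num.min (gromov_product d p x z) (gromov_product d p z y) - delta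
    <= gromov_product d p x y.
Hypothesis gsd : forall k x y, d (gs k x) (gs k y) = d x y.
Hypothesis giK : forall k, cancel (gi k) (gs k).
Hypothesis w_ge0 : forall k, 0 <= w k.
Hypothesis w_sum1 : (\sum_(0 <= k <oo) (w k)%:E = 1)%E.

Local Notation gp := (gromov_product d o).
Local Notation act := (act gs).
Local Notation actV := (actV gi).
Local Notation step := (total_step d o gs).

Lemma gp_act_cons c y x : gp y (act c x) <= step c + gp (actV c y) x.
Proof.
have := gp_translate o dm (actV c y) x (isometric_act gsd c).
by rewrite (actVK giK); have := dist_act_le o dm gsd c; lra.
Qed.

Variables (S : 'I_4 -> seq nat) (r : nat) (beta C : R).
Hypothesis beta_gt0 : 0 < beta.
Hypothesis C_ge0 : 0 <= C.
Hypothesis S_size : forall i, size (S i) = r.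
Hypothesis S_weight : forall i, weight w (S i) = beta.
Hypothesis S_far : forall i, 2 * C + 3 * delta < d (act (S i) o) o.
Hypothesis S_fork : forall i j, i != j -> gp (act (S i) o) (act (S j) o) <= C.
Hypothesis SV_fork : forall i j, i != j -> gp (actV (S i) o) (actV (S j) o) <= C.

(** True when the two directions are close: a block for which this holds has failed. *)
Definition misses (x y : X) : bool := C + delta < gp x y.

(** By [gp_iso_orbit], [act c x] stays in the direction of [act c o], which is far from that of [y].
    The displacement [2 * C + 3 * delta] is what excludes the other alternative of hyperbolicity. *)
Lemma gp_shadow c y x : c \in codom S -> ~~ misses y (act c o) ->
  ~~ misses (actV c o) x -> gp y (act c x) <= C + 2 * delta.
Proof.
move=> /codomP[i ->]; rewrite /misses -!leNgt => yc cx.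
have := gp_iso_orbit o dm x (actVK giK (S i)) (isometric_act gsd (S i)).
rewrite (gpC o dm (act (S i) o)).
have := S_far i; have := delta_ge0.
by have := gp_hyp o hyp (act (S i) x) y (act (S i) o) => -[?|?] ? ?; lra.
Qed.

Lemma misses_at_most_one (p : 'I_4 -> X) x i j :
  (forall i j, i != j -> gp (p i) (p j) <= C) -> i != j ->
  ~~ (misses x (p i) && misses x (p j)).
Proof.
move=> pC ij; apply/negP => /andP[]; rewrite /misses (gpC o dm x).
by have := gp_hyp o hyp x (p i) (p j); have := pC _ _ ij => ? [?|?] ? ?; lra.
Qed.

Definition factor (b : bool) c : R := if c \in codom S then if b then 2 else 2^-1 else 1.

Lemma factor_gt0 b c : 0 < factor b c.
Proof. by rewrite /factor; case: ifP => _; [case: b|]; lra. Qed.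

(** Reads failures against the direction of [y], carried along by the inverses of the earlier
    blocks: at each block that direction depends on earlier letters only. *)
Fixpoint bound_left (a : R) J y s : R :=
  if J is J'.+1 then
    let c := take r s in
    expR (a * (C + 2 * delta)) + expR (a * step c) * factor (misses y (act c o)) c *
      bound_left a J' (actV c y) (drop r s)
  else expR (a * step s).

(** The mirror image: the direction opposed to a block depends only on the letters that follow
    it. *)
Fixpoint bound_right (a : R) J s : R :=
  if J is J'.+1 then
    let c := take r s in
    expR (a * (C + 2 * delta)) +
      expR (a * step c) * factor (misses (actV c o) (act (drop r s) o)) c *
      bound_right a J' (drop r s)
  else expR (a * step s).

Lemma bound_left_ge0 a J y s : 0 <= bound_left a J y s.
Proof.
elim: J y s => [|J IH] y s /=; first exact: expR_ge0.
by rewrite addr_ge0 ?expR_ge0// mulr_ge0// mulr_ge0 ?expR_ge0// ltW ?factor_gt0.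
Qed.

Lemma bound_right_ge0 a J s : 0 <= bound_right a J s.
Proof.
elim: J s => [|J IH] s /=; first exact: expR_ge0.
by rewrite addr_ge0 ?expR_ge0// mulr_ge0// mulr_ge0 ?expR_ge0// ltW ?factor_gt0.
Qed.

(* A block that misses on either side multiplies one of the two weights [p],
   [q] by 2 and the other one by at least 1/2, so that [1 <= p * q] persists:
   one of the two products of factors stays at least 1 as long as no block in
   [S] succeeds on both sides. *)
Lemma expR_gp_le (a : R) J (p q : R) y s : 0 <= a -> 0 < p -> 0 < q -> 1 <= p * q ->
  expR (a * gp y (act s o)) <= p * bound_left a J y s + q * bound_right a J s.
Proof.
move=> a0; elim: J p q y s => [|J IH] p q y s p0 q0 pq.
  rewrite /= -mulrDl.
  have H : expR (a * gp y (act s o)) <= expR (a * step s).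
    rewrite ler_expR ler_wpM2l// (le_trans (gp_ler _ dm _ _))//.
    exact: dist_act_le.
  have ? : 1 <= p + q by nra.
  by rewrite (le_trans H)// ler_peMl ?expR_ge0.
have pq1 : 1 <= p + q by nra.
rewrite /= -{1}(cat_take_drop r s); set c := take r s; set t := drop r s.
set eC := expR (a * (C + 2 * delta)); set ec := expR (a * step c).
rewrite act_cat !mulrDr addrACA -mulrDl.
set p' := factor (misses y _) c; set q' := factor (misses (actV c o) _) c.
have ec0 : 0 <= ec := expR_ge0 _; have eC0 : 0 <= eC := expR_ge0 _.
have [p'0 q'0] : 0 < p' /\ 0 < q' by rewrite !factor_gt0.
have bl := bound_left_ge0 a J (actV c y) t; have br := bound_right_ge0 a J t.
(* From [1 <= p * q] follows [1 <= p + q], so after a successful block the additive terms alone are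
   large enough. *)
have [/and3P[cS yc cx]|bad] := boolP [&& c \in codom S, ~~ misses y (act c o) &
    ~~ misses (actV c o) (act t o)].
  apply: le_trans (_ : eC <= _).
    by rewrite ler_expR ler_wpM2l// gp_shadow.
  rewrite -[leLHS]addr0; apply: lerD; first by rewrite ler_peMl.
  by apply: addr_ge0; rewrite !mulr_ge0// ltW.
have pq' : 1 <= p' * q'.
  move: bad; rewrite /p' /q' /factor; case: (c \in codom S) => /=; last by rewrite mul1r.
  by case: misses; case: misses => //= _; lra.
apply: le_trans (_ : ec * expR (a * gp (actV c y) (act t o)) <= _).
  by rewrite -expRD ler_expR -mulrDr ler_wpM2l// gp_act_cons.
rewrite -[leLHS]add0r; apply: lerD; first by rewrite mulr_ge0// ltW// (lt_le_trans ltr01).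
have -> : p * (ec * p' * bound_left a J (actV c y) t) + q * (ec * q' * bound_right a J t)
  = ec * (p * p' * bound_left a J (actV c y) t + q * q' * bound_right a J t) by ring.
rewrite ler_wpM2l// IH ?mulr_gt0//.
have -> : p * p' * (q * q') = (p * q) * (p' * q') by ring.
by nra.
Qed.

Lemma S_inj i j : S i = S j -> i = j.
Proof.
move=> Sij; apply/eqP; apply: contraT => /S_fork; rewrite Sij /gromov_product (distxx dm).
by have := S_far j; have := delta_ge0; have := C_ge0; lra.
Qed.

Lemma Ex_S_indic (x : 'I_4 -> R) : (forall i, 0 <= x i) ->
  (Ex w r (fun c => (\sum_i (if c == S i then x i else 0))%:E) =
   (\sum_i beta * x i)%:E)%E.
Proof.
move=> x0.
have -> : (Ex w r (fun c => (\sum_i (if c == S i then x i else 0))%:E) =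
    Ex w r (fun c => \sum_i (if c == S i then (x i)%:E else 0)))%E.
  by apply: eq_Ex => c _; rewrite -sumEFin; apply: eq_bigr => i _; case: ifP.
rewrite Ex_sum//; last by move=> i c; case: ifP => // _; rewrite lee_fin.
rewrite -sumEFin; apply: eq_bigr => i _.
by rewrite -{1}(S_size i) Ex_indic ?lee_fin// -/(weight w _) S_weight.
Qed.

Lemma Ex_step (a m : R) n : (E1 w (fun k => (expR (a * d (gs k o) o))%:E) = m%:E)%E ->
  (Ex w n (fun s => (expR (a * step s))%:E) = (m ^+ n)%:E)%E.
Proof.
move=> am; rewrite -(Ex_prod w_ge0 n _ am); last by move=> k; exact: expR_ge0.
by apply: eq_Ex => s _; rewrite /total_step mulr_sumr expR_sum.
Qed.

(** Relative to 1, the four words lose [beta / 2] each by their factor 1/2, and the one that may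
    fail gains back [3 / 2 * beta]; the net change is at most [- beta / 2]. The exponential weight,
    counted twice because [factor] is at most 2, restores at most [2 * (beta / 8)]. *)
Lemma Ex_factor_le (a m : R) (b : seq nat -> bool) : 0 <= a ->
  (E1 w (fun k => (expR (a * d (gs k o) o))%:E) = m%:E)%E ->
  m ^+ r <= 1 + beta / 8 ->
  (forall i j, i != j -> ~~ (b (S i) && b (S j))) ->
  (Ex w r (fun c => (expR (a * step c) * factor (b c) c)%:E) <= (1 - beta / 4)%:E)%E.
Proof.
move=> a0 am mr bS.
pose lhs c := \sum_i (if c == S i then 2^-1 else 0 : R).
pose rhs c := \sum_i (if c == S i then if b (S i) then 3 / 2 else 0 else 0 : R).
have lhs0 c : 0 <= lhs c by apply: sumr_ge0 => i _; case: ifP => // _; lra.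
have rhs0 c : 0 <= rhs c.
  by apply: sumr_ge0 => i _; case: ifP => // _; case: ifP => // _; lra.
have bbeta : \sum_i beta * (if b (S i) then 3 / 2 else 0 : R) <= beta * (3 / 2).
  rewrite -mulr_sumr ler_pM2l//.
  have [[i bi]|/forallNP nb] := pselect (exists i, b (S i)).
    rewrite (bigD1 i)//= bi big1 ?addr0// => j ji.
    by have := bS _ _ ji; rewrite bi andbT => /negPf ->.
  by rewrite big1 => [|i _]; [lra|have /negP/negPf -> := nb i].
(* Every term is put on the side where it is nonnegative, so that expectations can be taken before
   any subtraction. *)
have point c : expR (a * step c) * factor (b c) c + (2 + lhs c)
    <= 1 + rhs c + 2 * expR (a * step c).
  have e1 : 1 <= expR (a * step c).
    rewrite -[leLHS]expR0 ler_expR mulr_ge0// sumr_ge0// => k _.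
    exact: dist_ge0.
  rewrite /factor; have [/codomP[i ci]|cN] := boolP (c \in codom S).
    have -> : lhs c = 2^-1.
      rewrite /lhs (bigD1 i)//= ci eqxx big1 ?addr0// => j ji.
      by case: eqP => // /S_inj ij; move: ji; rewrite ij eqxx.
    have -> : rhs c = if b c then 3 / 2 else 0.
      rewrite /rhs (bigD1 i)//= ci eqxx big1 ?addr0// => j ji.
      by case: eqP => // /S_inj ij; move: ji; rewrite ij eqxx.
    by case: (b c); lra.
  have := rhs0 c; suff -> : lhs c = 0 by lra.
  rewrite /lhs big1// => i _; case: eqP => // ci.
  by rewrite ci codom_f in cN.
have f0 c : 0 <= expR (a * step c) * factor (b c) c.
  by rewrite mulr_ge0 ?expR_ge0// ltW// factor_gt0.
have : (Ex w r (fun c => (expR (a * step c) * factor (b c) c)%:E + (2 + lhs c)%:E) <=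
   Ex w r (fun c => (1 + rhs c)%:E + (2%:E * (expR (a * step c))%:E)))%E.
  apply: le_Ex => // c _; last by rewrite -EFinM -!EFinD lee_fin.
  by rewrite -EFinD lee_fin addr_ge0// addr_ge0.
rewrite [leLHS](ExD w_ge0); last 2 first.
- by move=> c; rewrite lee_fin.
- by move=> c; rewrite lee_fin addr_ge0.
rewrite [leRHS](ExD w_ge0); last 2 first.
- by move=> c; rewrite lee_fin addr_ge0.
- by move=> c; rewrite -EFinM lee_fin mulr_ge0// expR_ge0.
rewrite ExZ//.
rewrite (Ex_step _ am).
have Ecst x (F : seq nat -> R) : 0 <= x -> (forall c, 0 <= F c) ->
    (Ex w r (fun c => (x + F c)%:E) = x%:E + Ex w r (fun c => (F c)%:E))%E.
  move=> x0 F0; have x0' : (0 <= x%:E)%E by rewrite lee_fin.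
  by rewrite -[in RHS](Ex_cst w_ge0 w_sum1 r x0') -(ExD w_ge0)// => c; rewrite lee_fin.
rewrite !Ecst// Ex_S_indic; last by move=> i; lra.
rewrite Ex_S_indic; last by move=> i; case: ifP => // _; lra.
rewrite sumr_const card_ord -EFinM -!EFinD -leeBrDr// -EFinB => /le_trans-> //.
by rewrite lee_fin -[_ *+ 4]mulr_natr; have := bbeta; lra.
Qed.

Lemma Ex_affine n x y (F : seq nat -> R) : 0 <= x -> 0 <= y -> (forall s, 0 <= F s) ->
  (Ex w n (fun s => (x + y * F s)%:E) = x%:E + y%:E * Ex w n (fun s => (F s)%:E))%E.
Proof.
move=> x0 y0 F0; have x0' : (0 <= x%:E)%E by rewrite lee_fin.
rewrite -[in RHS](Ex_cst w_ge0 w_sum1 n x0') -ExZ// -(ExD w_ge0)// => s.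
by rewrite -EFinM lee_fin mulr_ge0.
Qed.

Section ExpectedBounds.
Variables (a m : R).
Hypothesis a_ge0 : 0 <= a.
Hypothesis am : (E1 w (fun k => (expR (a * d (gs k o) o))%:E) = m%:E)%E.
Hypothesis m_ge1 : 1 <= m.
Hypothesis mr : m ^+ r <= 1 + beta / 8.

(** The first term is the fixed point of [x |-> expR (a * (C + 2 * delta)) + (1 - beta / 4) * x];
    the second pays for the last, incomplete block. *)
Let B := 4 * expR (a * (C + 2 * delta)) / beta + m ^+ r.

Let B_ge0 : 0 <= B.
Proof.
rewrite addr_ge0// ?exprn_ge0//; last by rewrite (le_trans ler01).
by rewrite divr_ge0 ?(ltW beta_gt0)// mulr_ge0// expR_ge0.
Qed.

Let B_step : expR (a * (C + 2 * delta)) + B * (1 - beta / 4) <= B.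
Proof.
have -> : expR (a * (C + 2 * delta)) + B * (1 - beta / 4) = B - beta / 4 * m ^+ r.
  by rewrite /B; field; rewrite gt_eqF.
rewrite gerBl mulr_ge0// ?exprn_ge0//; first by have := beta_gt0; lra.
by rewrite (le_trans ler01).
Qed.

Let Ex_step_rem q : (q <= r)%N -> (Ex w q (fun s => (expR (a * step s))%:E) <= B%:E)%E.
Proof.
move=> qr; rewrite (Ex_step _ am) lee_fin; apply: (@le_trans _ _ (m ^+ r)).
  by rewrite ler_weXn2l.
by rewrite /B lerDr divr_ge0 ?(ltW beta_gt0)// mulr_ge0// expR_ge0.
Qed.

Let Ex_block_le (b : seq nat -> bool) :
  (forall i j, i != j -> ~~ (b (S i) && b (S j))) ->
  (Ex w r (fun c => (expR (a * (C + 2 * delta)) +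
     B * (expR (a * step c) * factor (b c) c))%:E) <= B%:E)%E.
Proof.
move=> bS; rewrite Ex_affine ?expR_ge0//; last first.
  by move=> c; rewrite mulr_ge0 ?expR_ge0// ltW// factor_gt0.
apply: (@le_trans _ _ ((expR (a * (C + 2 * delta)))%:E + B%:E * (1 - beta / 4)%:E)%E).
  apply: leeD2l; apply: lee_wpmul2l; first by rewrite lee_fin.
  exact: (Ex_factor_le a_ge0 am).
by rewrite -EFinM -EFinD lee_fin.
Qed.

(** With the first block fixed, the induction hypothesis holds uniformly in the transported point
    [actV c y]; the block is averaged afterwards. *)
Lemma Ex_bound_left J q y : (q <= r)%N ->
  (Ex w (J * r + q) (fun s => (bound_left a J y s)%:E) <= B%:E)%E.
Proof.
move=> qr; elim: J y => [|J IH] y; first exact: Ex_step_rem.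
rewrite mulSn -addnA Ex_cat.
apply: le_trans (Ex_block_le (b := fun c => misses y (act c o)) _); last first.
  by move=> i j ij; rewrite (misses_at_most_one (p := fun i => act (S i) o)).
apply: le_Ex => // c cr.
  by apply: Ex_ge0 => // s _; rewrite lee_fin (bound_left_ge0 a J.+1).
rewrite (eq_Ex _ (G := fun t => (expR (a * (C + 2 * delta)) + expR (a * step c) *
    factor (misses y (act c o)) c * bound_left a J (actV c y) t)%:E)); last first.
  by move=> t _; rewrite /= take_size_cat ?drop_size_cat.
have K0 : 0 <= expR (a * step c) * factor (misses y (act c o)) c.
  by rewrite mulr_ge0 ?expR_ge0// ltW// factor_gt0.
rewrite Ex_affine ?expR_ge0// => [|s]; last exact: bound_left_ge0.
by rewrite (mulrC B) EFinD [in leRHS]EFinM; apply: leeD2l; apply: lee_wpmul2l; rewrite ?lee_fin.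
Qed.

(** Here the rest of the word is fixed and the first block is averaged before the induction
    hypothesis is used. *)
Lemma Ex_bound_right J q : (q <= r)%N ->
  (Ex w (J * r + q) (fun s => (bound_right a J s)%:E) <= B%:E)%E.
Proof.
move=> qr; elim: J => [|J IH]; first exact: Ex_step_rem.
rewrite mulSn -addnA Ex_catr//; last by move=> s; rewrite lee_fin (bound_right_ge0 a J.+1).
pose K t c := expR (a * step c) * factor (misses (actV c o) (act t o)) c.
have K0 t c : 0 <= K t c.
  by rewrite mulr_ge0 ?expR_ge0// ltW// factor_gt0.
apply: (@le_trans _ _ (Ex w (J * r + q) (fun t => (expR (a * (C + 2 * delta)) +
    (1 - beta / 4) * bound_right a J t)%:E))).
  apply: le_Ex => // t _.
    by apply: Ex_ge0 => // s _; rewrite lee_fin (bound_right_ge0 a J.+1).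
  rewrite (eq_Ex _ (G := fun c => (expR (a * (C + 2 * delta)) +
      bound_right a J t * K t c)%:E)); last first.
    by move=> c cr; rewrite /K /= take_size_cat// drop_size_cat//; congr (_ + _)%:E; rewrite mulrC.
  rewrite Ex_affine ?expR_ge0 ?bound_right_ge0//.
  rewrite (mulrC (1 - beta / 4)) EFinD (EFinM (bound_right _ _ _)); apply: leeD2l; apply: lee_wpmul2l.
    by rewrite lee_fin bound_right_ge0.
  apply: (Ex_factor_le (b := fun c => misses (actV c o) (act t o)) a_ge0 am mr).
  move=> i j ij; rewrite /misses !(gpC o dm _ (act t o)).
  exact: (misses_at_most_one (p := fun i => actV (S i) o)).
have b4 : 0 <= 1 - beta / 4.
  rewrite -lee_fin; apply: le_trans (Ex_factor_le (b := xpred0) a_ge0 am mr _) => //.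
  by apply: Ex_ge0 => // s _; rewrite lee_fin mulr_ge0 ?expR_ge0// ltW// factor_gt0.
rewrite Ex_affine ?expR_ge0//; last by move=> s; exact: bound_right_ge0.
apply: (@le_trans _ _ ((expR (a * (C + 2 * delta)))%:E + (1 - beta / 4)%:E * B%:E)%E).
  by apply: leeD2l; apply: lee_wpmul2l; rewrite ?lee_fin.
by rewrite -EFinM -EFinD lee_fin (mulrC (1 - beta / 4)).
Qed.

Lemma Ex_expR_gp_le n y :
  (Ex w n (fun s => (expR (a * gp y (act s o)))%:E) <= (2 * B)%:E)%E.
Proof.
have [J [q [qr ->]]] : exists J q, (q <= r)%N /\ n = (J * r + q)%N.
  have r0 : (0 < r)%N.
    rewrite lt0n; apply/eqP => r0; have := S_far ord0.
    have /size0nil -> : size (S ord0) = 0%N by rewrite S_size.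
    by rewrite /= (distxx dm); have := delta_ge0; have := C_ge0; lra.
  by exists (n %/ r)%N, (n %% r)%N; rewrite -divn_eq ltnW// ltn_mod.
apply: (@le_trans _ _ (Ex w (J * r + q)
    (fun s => (bound_left a J y s)%:E + (bound_right a J s)%:E)%E)).
  apply: le_Ex => // s _.
  have := expR_gp_le J y s a_ge0 ltr01 ltr01; rewrite !mul1r -EFinD lee_fin; exact.
rewrite (ExD w_ge0); last 2 first.
- by move=> s; rewrite lee_fin bound_left_ge0.
- by move=> s; rewrite lee_fin bound_right_ge0.
rewrite mulr2n mulrDl mul1r EFinD leeD//; [exact: Ex_bound_left|exact: Ex_bound_right].
Qed.

End ExpectedBounds.

End GromovProductTail.

Section UniformTail.
Context {R : realType} {X : Type} (d : X -> X -> R) (o : X).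
Context (gs gi : nat -> X -> X) (w : nat -> R).
Hypothesis dm : is_metric d.
Hypothesis hyp : gromov_hyperbolic d.
Hypothesis gsd : forall k x y, d (gs k x) (gs k y) = d x y.
Hypothesis gsK : forall k, cancel (gs k) (gi k).
Hypothesis giK : forall k, cancel (gi k) (gs k).
Hypothesis w_ge0 : forall k, 0 <= w k.
Hypothesis w_sum1 : (\sum_(0 <= k <oo) (w k)%:E = 1)%E.
Hypothesis ne : non_elementary d o gs w.
Hypothesis em : exp_moment d o gs w.

Lemma exp_moment_E1 : exists alpha m, 0 < alpha /\
  (E1 w (fun k => (expR (alpha * d (gs k o) o))%:E) = m%:E)%E.
Proof.
have [alpha [alpha0 fin]] := em.
exists alpha, (fine (\sum_(0 <= k <oo) (w k * expR (alpha * d (gs k o) o))%:E)%E).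
split=> //; rewrite fineK; first by apply: eq_eseriesr => k _; rewrite EFinM.
rewrite ge0_fin_numE// nneseries_ge0// => k _ _.
by rewrite lee_fin mulr_ge0// expR_ge0.
Qed.

Lemma gromov_product_exp_moment : exists a A, 0 < a /\ forall n y,
  (Ex w n (fun s => (expR (a * gromov_product d o y (act gs s o)))%:E) <= A%:E)%E.
Proof.
have [delta [delta0 hyp4]] := hyp.
have [alpha [m [alpha0 um]]] := exp_moment_E1.
have [S [r [beta [C [beta0 C0 SP Sf SVf]]]]] :=
  schottky_words dm gsK giK delta0 hyp4 ne (3 * delta).
have u0 k : 0 <= d (gs k o) o by exact: dist_ge0.
have m1 := moment_ge1 w_ge0 w_sum1 u0 alpha0 um.
pose L := ln (1 + beta / 8).
have L0 : 0 < L by rewrite ln_gt0// ltrDl divr_gt0.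
(* The words, hence [r] and [beta], are fixed before the exponent. This [t] gives [mt ^+ r <= expR
   (r%:R * (t * m)) <= expR L]. *)
pose t := Num.min 1 (L / ((m + 1) * (r%:R + 1))).
have den0 : 0 < (m + 1) * (r%:R + 1) by rewrite mulr_gt0// ltr_wpDl// (le_trans ler01).
have t0 : 0 < t by rewrite lt_min ltr01 divr_gt0.
have t01 : 0 <= t <= 1 by rewrite (ltW t0) ge_min lexx.
have [mt mtE /andP[mt1 mtm]] := small_moment w_ge0 w_sum1 u0 alpha0 um t01.
have mtr : mt ^+ r <= 1 + beta / 8.
  have b0 : 0 < 1 + beta / 8 by rewrite addr_gt0// divr_gt0.
  rewrite -(lnK b0) -/L; apply: (@le_trans _ _ (expR (t * m) ^+ r)).
    rewrite lerXn2r ?nnegrE ?expR_ge0// ?(le_trans ler01)//.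
    by rewrite (le_trans mtm)// expR_ge1Dx.
  rewrite -expRM_natl ler_expR.
  have : t * ((m + 1) * (r%:R + 1)) <= L by rewrite -ler_pdivlMr// ge_min lexx orbT.
  have r0 : 0 <= r%:R :> R by [].
  by nra.
exists (t * alpha); eexists; split; first exact: mulr_gt0.
move=> n y.
by apply: (Ex_expR_gp_le dm delta0 hyp4 gsd giK w_ge0 w_sum1 beta0 C0 _ _ _ Sf SVf
  _ mtE mt1 mtr) => [i|i|i|]; [by have [] := SP i|by have [] := SP i|by have [] := SP i|rewrite mulr_ge0// ltW].
Qed.

End UniformTail.

(** * Exponential moment of one centered step *)

Section ElementaryExp.
Context {R : realType}.
Implicit Types x l t : R.

Lemma sqr_le_expR t x : 0 < t -> 0 <= x -> x ^+ 2 <= 2 / t ^+ 2 * expR (t * x).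
Proof.
move=> t0 x0; have := expR_ge1Dxn 1 (mulr_ge0 (ltW t0) x0).
rewrite [2`!](_ : _ = 2%N)// exprMn => H.
rewrite mulrAC ler_pdivlMr ?exprn_gt0//; lra.
Qed.

Lemma le_expR_div t x : 0 < t -> x <= expR (t * x) / t.
Proof.
by move=> t0; rewrite ler_pdivlMr// mulrC; have := expR_ge1Dx (t * x); lra.
Qed.

Lemma expR_sub1_le x : expR x - 1 <= x * expR x.
Proof. by have := expR_tangent 0 x; rewrite expR0; lra. Qed.

Lemma expR_quadratic x : expR x <= 1 + x + x ^+ 2 * expR `|x|.
Proof.
have H := expR_sub1_le x; have H2 := expR_ge1Dx x.
have [x0|x0] := leP 0 x; first by rewrite ger0_norm//; nra.
have : 1 <= expR `|x| by rewrite -{1}expR0 ler_expR.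
by nra.
Qed.
End ElementaryExp.

Section CenteredStep.
Context {R : realType} (w : nat -> R) (u : nat -> R) (alpha m K : R).
Hypothesis w_ge0 : forall k, 0 <= w k.
Hypothesis w_sum1 : (\sum_(0 <= k <oo) (w k)%:E = 1)%E.
Hypothesis u_ge0 : forall k, 0 <= u k.
Hypothesis alpha_gt0 : 0 < alpha.
Hypothesis K_ge0 : 0 <= K.
Hypothesis um : (E1 w (fun k => (expR (alpha * u k))%:E) = m%:E)%E.

(** [72 / alpha ^+ 2] is [2 / (alpha / 6) ^+ 2], from bounding a square by an exponential of rate
    [alpha / 6]. The remainder of the quadratic expansion gives a second exponential of that rate,
    and for a step bounded by [3 * u + K] the two make up
    [expR (alpha * u) * expR (alpha / 3 * K)]. *)
Definition step_constant := 72 / alpha ^+ 2 * expR (alpha / 3 * K) * m.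

Lemma step_constant_ge0 : 0 <= step_constant.
Proof.
rewrite mulr_ge0//; first by rewrite mulr_ge0 ?expR_ge0// divr_ge0// exprn_ge0// ltW.
by rewrite -lee_fin -um; apply: E1_ge0.
Qed.

(** Writing the centered step as [U - V] with nonnegative [U] and [V] of equal mean lets the linear
    terms cancel without ever integrating a signed function. Exchanging [U] and [V] covers negative
    [l]. *)
Lemma expR_centered_step (U V : nat -> R) z l : `|l| <= alpha / 6 ->
  (forall k, 0 <= U k) -> (forall k, 0 <= V k) ->
  (forall k, `|U k - V k| <= 3 * u k + K) ->
  (E1 w (fun k => (U k)%:E) = z%:E)%E -> (E1 w (fun k => (V k)%:E) = z%:E)%E ->
  (E1 w (fun k => (expR (l * (U k - V k)))%:E) <= (1 + step_constant * l ^+ 2)%:E)%E.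
Proof.
wlog l0 : U V l / 0 <= l => [wl|].
  have [/wl|l0] := leP 0 l; first exact.
  move=> la U0 V0 UV EU EV; rewrite -sqrrN.
  under eq_E1 do rewrite -mulrNN opprB.
  apply: wl => //; first by rewrite oppr_ge0 ltW.
    by rewrite normrN.
  by move=> k; rewrite distrC.
rewrite ger0_norm// => la U0 V0 UV EU EV.
pose c0 := 72 / alpha ^+ 2 * expR (alpha / 3 * K).
have c00 : 0 <= c0 by rewrite mulr_ge0 ?expR_ge0// divr_ge0// exprn_ge0// ltW.
have point k : expR (l * (U k - V k)) + l * V k <=
    1 + (l * U k + (c0 * l ^+ 2) * expR (alpha * u k)).
  set x := U k - V k; set y := 3 * u k + K.
  have y0 : 0 <= y by rewrite addr_ge0// mulr_ge0.
  have H1 := expR_quadratic (l * x).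
  have H2 : `|l * x| <= alpha / 6 * y by rewrite normrM (ger0_norm l0) ler_pM ?normr_ge0 ?UV.
  have a6 : 0 < alpha / 6 by rewrite divr_gt0.
  have H3 := sqr_le_expR a6 y0.
  have H4 : x ^+ 2 <= y ^+ 2 by rewrite -[x ^+ 2]real_normK ?num_real// lerXn2r ?nnegrE ?normr_ge0 ?UV.
  have H5 : (l * x) ^+ 2 * expR `|l * x| <= c0 * l ^+ 2 * expR (alpha * u k).
    have -> : c0 * l ^+ 2 * expR (alpha * u k) =
        l ^+ 2 * (2 / (alpha / 6) ^+ 2 * expR (alpha / 6 * y)) * expR (alpha / 6 * y).
      have -> : alpha * u k = alpha / 6 * y + alpha / 6 * y - alpha / 3 * K.
        by rewrite /y; field.
      rewrite expRD expRN expRD /c0; field.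
      by rewrite (gt_eqF (expR_gt0 _)) gt_eqF.
    rewrite exprMn; apply: ler_pM; [|exact: expR_ge0| |by rewrite ler_expR].
      by rewrite mulr_ge0 ?sqr_ge0.
    by rewrite ler_wpM2l ?sqr_ge0// (le_trans H4).
  have e : l * x = l * U k - l * V k by rewrite mulrBr.
  by clearbody x; lra.
have : (E1 w (fun k => (expR (l * (U k - V k)))%:E + l%:E * (V k)%:E) <=
   E1 w (fun k => 1%:E + (l%:E * (U k)%:E +
     (c0 * l ^+ 2)%:E * (expR (alpha * u k))%:E)))%E.
  apply: le_E1 => // k. by rewrite -EFinM -EFinD lee_fin addr_ge0 ?expR_ge0// mulr_ge0.
rewrite [leLHS](E1D w_ge0); last 2 first.
- by move=> k; rewrite lee_fin expR_ge0.
- by move=> k; rewrite -EFinM lee_fin mulr_ge0.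
rewrite [leRHS](E1D w_ge0); last 2 first.
- by [].
- by move=> k; rewrite -!EFinM -EFinD lee_fin addr_ge0// mulr_ge0 ?expR_ge0// mulr_ge0 ?sqr_ge0.
rewrite (E1_cst w_ge0 w_sum1 lee01) (E1D w_ge0); last 2 first.
- by move=> k; rewrite -EFinM lee_fin mulr_ge0.
- by move=> k; rewrite -EFinM lee_fin mulr_ge0 ?expR_ge0// mulr_ge0 ?sqr_ge0.
rewrite !E1Z//; last first.
- by rewrite mulr_ge0 ?sqr_ge0.
rewrite EU EV um -!EFinM -!EFinD -leeBrDr// -EFinB => /le_trans-> //.
by rewrite lee_fin /step_constant -/c0; lra.
Qed.
End CenteredStep.

(** [b] is the supremum of the ratios [(f n.+1 - C) / n.+1%:R]. Each of them lies below each
    [f k.+1 / k.+1%:R], as both compare with [f] at the product [k.+1 * n.+1]. *)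
Lemma almost_additive_drift {R : realType} (f : nat -> R) (C : R) :
  (forall n, 0 <= f n) ->
  (forall n m, f (n + m)%N <= f n + f m) ->
  (forall n m, f n + f m <= f (n + m)%N + C) ->
  exists b, forall n, n%:R * b <= f n <= n%:R * b + C.
Proof.
move=> f0 fsub fsup.
have sub k n : f (k.+1 * n)%N <= k.+1%:R * f n.
  elim: k => [|k IH]; first by rewrite mul1n mul1r.
  rewrite mulSn (le_trans (fsub _ _))// -[k.+2%:R]natr1 mulrDl mul1r addrC.
  by rewrite lerD2r.
have sup k n : k.+1%:R * f n <= f (k.+1 * n)%N + k%:R * C.
  elim: k => [|k IH]; first by rewrite mul1n mul1r mul0r addr0.
  rewrite mulSn; have := fsup n (k.+1 * n)%N.
  by rewrite -[k.+2%:R]natr1; move: IH; rewrite -[k.+1%:R]natr1; lra.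
have C0 : 0 <= C by have := fsup 0%N 0%N; have := f0 0%N; rewrite addn0; lra.
have cross n k : (f n.+1 - C) / n.+1%:R <= f k.+1 / k.+1%:R.
  rewrite ler_pdivrMr// mulrAC ler_pdivlMr// mulrC [leRHS]mulrC.
  have := sup k n.+1; have := sub n k.+1; rewrite mulnC.
  by rewrite -[k.+1%:R]natr1; lra.
pose E := [set (f n.+1 - C) / n.+1%:R | n in [set: nat]].
have Eub k : ubound E (f k.+1 / k.+1%:R) by move=> _ [n _ <-]; exact: cross.
have supE : has_sup E.
  by split; [exists ((f 1%N - C) / 1%:R), 0%N|exists (f 1%N / 1%:R); exact: Eub].
exists (reals.sup E) => -[|n].
  rewrite !mul0r f0 add0r.
  by have := fsup 0%N 0%N; rewrite addn0; lra.
rewrite mulrC -ler_pdivlMr// ge_sup//=; last exact: supE.1.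
rewrite -lerBlDr -ler_pdivrMr//; apply: ub_le_sup; last by exists n.
exact: supE.2.
Qed.

(** * Mean displacement and the martingale bound *)

Section DistanceMoments.
Context {R : realType} {X : Type} (d : X -> X -> R) (o : X).
Context (gs gi : nat -> X -> X) (w : nat -> R) (alpha m a A : R).
Hypothesis dm : is_metric d.
Hypothesis gsd : forall k x y, d (gs k x) (gs k y) = d x y.
Hypothesis giK : forall k, cancel (gi k) (gs k).
Hypothesis w_ge0 : forall k, 0 <= w k.
Hypothesis w_sum1 : (\sum_(0 <= k <oo) (w k)%:E = 1)%E.
Hypothesis alpha_gt0 : 0 < alpha.
Hypothesis um : (E1 w (fun k => (expR (alpha * d (gs k o) o))%:E) = m%:E)%E.
Hypothesis a_gt0 : 0 < a.
Hypothesis tail : forall n y,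
  (Ex w n (fun s => (expR (a * gromov_product d o y (act gs s o)))%:E) <= A%:E)%E.

Local Notation gp := (gromov_product d o).
Local Notation act := (act gs).
Local Notation actV := (actV gi).
Local Notation step := (total_step d o gs).
Local Notation D s := (d (act s o) o).

Definition rex n (F : seq nat -> R) : R := fine (Ex w n (fun s => (F s)%:E)).

Lemma rexE n F c : (forall s, 0 <= F s) ->
  (forall s, F s <= c * expR (alpha * step s)) ->
  (Ex w n (fun s => (F s)%:E) = (rex n F)%:E)%E.
Proof.
move=> F0 Fc; rewrite /rex fineK// ge0_fin_numE; last first.
  by apply: Ex_ge0 => // s _; rewrite lee_fin.
have c0 : 0 <= c.
  by have := le_trans (F0 [::]) (Fc [::]); rewrite pmulr_lge0// expR_gt0.
apply: (@le_lt_trans _ _ (c * m ^+ n)%:E); last exact: ltry.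
rewrite (EFinM c) -(@Ex_step _ _ d o gs _ w_ge0 _ _ n um) -ExZ//.
by apply: le_Ex => // s _; rewrite -?EFinM lee_fin.
Qed.

Lemma rex_ge0 n F : (forall s, 0 <= F s) -> 0 <= rex n F.
Proof. by move=> F0; apply: fine_ge0; apply: Ex_ge0 => // s _; rewrite lee_fin. Qed.

(* Its mean is within a bounded distance of the mean displacement, uniformly in
   [y], because the Gromov products have bounded expectation. *)
Definition horo y s := d (act s o) y - d o y.

Lemma step_ge0 s : 0 <= step s.
Proof. by apply: sumr_ge0 => k _; exact: dist_ge0. Qed.

Lemma horo_gp y s : horo y s + 2 * gp y (act s o) = D s.
Proof. by rewrite /horo /gromov_product (distC dm o y) (distC dm y (act s o)); lra. Qed.

Lemma horo_le y s : horo y s <= D s.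
Proof. by rewrite -(horo_gp y s) lerDl mulr_ge0// gp_ge0. Qed.

Lemma horo_ge y s : - D s <= horo y s.
Proof.
rewrite /horo; have := dist_triangle dm (act s o) o y.
by rewrite (distC dm o (act s o)); lra.
Qed.

Lemma horo_o s : horo o s = D s. Proof. by rewrite /horo (distxx dm) subr0. Qed.

Lemma dist_actV s x y : d (act s x) y = d x (actV s y).
Proof. by rewrite -[RHS](isometric_act gsd s) (actVK giK). Qed.

Lemma horo_cons y k t : horo y (k :: t) = horo (gi k y) t + (d o (gi k y) - d o y).
Proof.
rewrite /horo /= -{1}(giK k y) gsd; lra.
Qed.

Lemma horo_cocycle k y : `|d o (gi k y) - d o y| <= d (gs k o) o.
Proof.
have -> : d o (gi k y) = d (gs k o) y by rewrite -(gsd k) giK.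
rewrite ler_norml; have := dist_triangle dm (gs k o) o y.
have := dist_triangle dm o (gs k o) y; rewrite (distC dm o (gs k o)).
by move=> ? ?; apply/andP; split; lra.
Qed.

(** Reduces concatenations to [horo], for which the estimates are uniform in the base point. *)
Lemma dist_cat s t : D (s ++ t) = D s + horo (actV s o) t.
Proof.
by rewrite act_cat dist_actV /horo -(dist_actV s o); lra.
Qed.

Lemma le_step_exp s : step s <= alpha^-1 * expR (alpha * step s).
Proof. by rewrite mulrC le_expR_div. Qed.

Lemma Ex_dist n : (Ex w n (fun s => (D s)%:E) = (rex n (fun s => D s))%:E)%E.
Proof.
apply: (rexE _ (c := alpha^-1)) => s; first exact: dist_ge0.
by rewrite (le_trans (dist_act_le o dm gsd s))// le_step_exp.
Qed.

Lemma A_ge0 : 0 <= A.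
Proof. by rewrite -lee_fin (le_trans _ (tail 0 o))// lee_fin expR_ge0. Qed.

Lemma mean_gp_le n y : (Ex w n (fun s => (gp y (act s o))%:E) <= (A / a)%:E)%E.
Proof.
have -> : (A / a)%:E = (a^-1%:E * A%:E)%E by rewrite -EFinM mulrC.
apply: (@le_trans _ _ (a^-1%:E * Ex w n (fun s => (expR (a * gp y (act s o)))%:E))%E).
  rewrite -ExZ ?invr_ge0 ?(ltW a_gt0)//.
  apply: le_Ex => // s _; first by rewrite lee_fin gp_ge0.
  by rewrite -EFinM lee_fin mulrC le_expR_div.
by apply: lee_wpmul2l => //; rewrite lee_fin invr_ge0 ltW.
Qed.

Local Notation f n := (rex n (fun s => D s)).
Local Notation G := (2 * (A / a)).

Lemma Ex_cat_add n k (F H : seq nat -> R) : (forall s, 0 <= F s) -> (forall s, 0 <= H s) ->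
  (Ex w n (fun s => Ex w k (fun t => (F s + H t)%:E)) =
   Ex w n (fun s => (F s)%:E) + Ex w k (fun t => (H t)%:E))%E.
Proof.
move=> F0 H0; have H0' : (0 <= Ex w k (fun t => (H t)%:E))%E.
  by apply: Ex_ge0 => // s _; rewrite lee_fin.
rewrite -[in RHS](Ex_cst w_ge0 w_sum1 n H0') -(ExD w_ge0)//.
apply: eq_Ex => s _.
have Fs0 : (0 <= (F s)%:E)%E by rewrite lee_fin.
by rewrite -[in RHS](Ex_cst w_ge0 w_sum1 k Fs0) -(ExD w_ge0).
Qed.

Lemma mean_dist_subadd n k : f (n + k)%N <= f n + f k.
Proof.
rewrite -lee_fin EFinD -!Ex_dist Ex_cat -Ex_cat_add; try by move=> s; exact: dist_ge0.
apply: le_Ex => // s _; first by apply: Ex_ge0 => // t _; rewrite lee_fin dist_ge0.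
apply: le_Ex => // t _; first by rewrite lee_fin dist_ge0.
by rewrite lee_fin dist_cat lerD2l horo_le.
Qed.

Lemma mean_dist_superadd n k : f n + f k <= f (n + k)%N + G.
Proof.
rewrite -lee_fin !EFinD -!Ex_dist Ex_cat -Ex_cat_add; try by move=> s; exact: dist_ge0.
have G0 : (0 <= G%:E)%E by rewrite lee_fin mulr_ge0// divr_ge0 ?A_ge0// ltW.
rewrite -[X in (_ + X)%E](Ex_cst w_ge0 w_sum1 n G0) -(ExD w_ge0); last 2 first.
- by move=> s; apply: Ex_ge0 => // t _; rewrite lee_fin dist_ge0.
- by [].
apply: le_Ex => // s _.
  by apply: Ex_ge0 => // t _; rewrite lee_fin addr_ge0// dist_ge0.
apply: (@le_trans _ _ (Ex w k (fun t => (D (s ++ t))%:E +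
    2%:E * (gp (actV s o) (act t o))%:E)%E)).
  apply: le_Ex => // t _; first by rewrite lee_fin addr_ge0// dist_ge0.
  by rewrite -EFinM -EFinD lee_fin dist_cat -(horo_gp (actV s o) t) addrA.
rewrite (ExD w_ge0); last 2 first.
- by move=> t; rewrite lee_fin dist_ge0.
- by move=> t; rewrite -EFinM lee_fin mulr_ge0// gp_ge0.
rewrite ExZ//; last by move=> t; rewrite lee_fin gp_ge0.
by rewrite EFinM; apply: leeD2l; apply: lee_wpmul2l; rewrite ?lee_fin ?mean_gp_le.
Qed.

Lemma mean_dist_drift : exists b, forall n, n%:R * b <= f n <= n%:R * b + G.
Proof.
apply: almost_additive_drift mean_dist_subadd mean_dist_superadd => n.
by apply: rex_ge0 => s; exact: dist_ge0.
Qed.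

(* Adding the total step length makes the cocycle nonnegative without
   changing its centered increments. *)
Definition lifted n y : R := rex n (fun s => horo y s + step s).

Let lifted_integrand_ge0 y s : 0 <= horo y s + step s.
Proof. by have := horo_ge y s; have := dist_act_le o dm gsd s; lra. Qed.

Lemma lifted_ge0 n y : 0 <= lifted n y.
Proof. exact: rex_ge0. Qed.

Lemma Ex_lifted n y : (Ex w n (fun s => (horo y s + step s)%:E) = (lifted n y)%:E)%E.
Proof.
apply: (rexE _ (c := 2 * alpha^-1)) => // s.
have := horo_le y s; have := dist_act_le o dm gsd s; have := le_step_exp s.
by lra.
Qed.

Lemma lifted_close n y : lifted n y <= lifted n o <= lifted n y + G.
Proof.
apply/andP; split; rewrite -lee_fin.
  rewrite -!Ex_lifted; apply: le_Ex => // s _; first by rewrite lee_fin.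
  by rewrite lee_fin lerD2r horo_o horo_le.
rewrite EFinD -!Ex_lifted.
apply: (@le_trans _ _ (Ex w n (fun s => (horo y s + step s)%:E +
    2%:E * (gp y (act s o))%:E)%E)).
  apply: le_Ex => // s _; first by rewrite lee_fin.
  by rewrite -EFinM -EFinD lee_fin horo_o -(horo_gp y s); lra.
rewrite (ExD w_ge0); last 2 first.
- by move=> t; rewrite lee_fin.
- by move=> t; rewrite -EFinM lee_fin mulr_ge0// gp_ge0.
rewrite ExZ//; last by move=> t; rewrite lee_fin gp_ge0.
by rewrite EFinM; apply: leeD2l; apply: lee_wpmul2l; rewrite ?lee_fin ?mean_gp_le.
Qed.

Definition mean_step : R := fine (E1 w (fun k => (d (gs k o) o)%:E)).

Lemma E1_mean_step : (E1 w (fun k => (d (gs k o) o)%:E) = mean_step%:E)%E.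
Proof.
rewrite /mean_step fineK// ge0_fin_numE; last first.
  by apply: E1_ge0 => // k; rewrite lee_fin dist_ge0.
apply: (@le_lt_trans _ _ (alpha^-1 * m)%:E); last exact: ltry.
rewrite EFinM -um -E1Z// ?invr_ge0 ?(ltW alpha_gt0)//.
apply: le_E1 => // k; first by rewrite lee_fin dist_ge0.
by rewrite -EFinM lee_fin mulrC le_expR_div.
Qed.

Lemma mean_step_ge0 : 0 <= mean_step.
Proof. by apply: fine_ge0; apply: E1_ge0 => // k; rewrite lee_fin dist_ge0. Qed.

Let cocycle_ge0 k y : 0 <= d o (gi k y) - d o y + d (gs k o) o.
Proof. by have := horo_cocycle k y; rewrite ler_norml => /andP[? _]; lra. Qed.

Lemma Ex_horo_cons n y k :
  (Ex w n (fun t => (horo y (k :: t) + step (k :: t))%:E) =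
   (lifted n (gi k y) + (d o (gi k y) - d o y + d (gs k o) o))%:E)%E.
Proof.
rewrite EFinD -Ex_lifted.
have c0 : (0 <= (d o (gi k y) - d o y + d (gs k o) o)%:E)%E by rewrite lee_fin.
rewrite -[X in (_ + X)%E](Ex_cst w_ge0 w_sum1 n c0) -(ExD w_ge0)//; last first.
  by move=> s; rewrite lee_fin.
apply: eq_Ex => t _; rewrite -EFinD horo_cons /total_step big_cons.
by congr _%:E; ring.
Qed.

Lemma lifted_rec n y :
  (E1 w (fun k => (lifted n (gi k y) + (d o (gi k y) - d o y + d (gs k o) o))%:E) =
   (lifted n.+1 y)%:E)%E.
Proof. by rewrite -Ex_lifted /=; apply: eq_E1 => k; rewrite Ex_horo_cons. Qed.

(** The lift itself contributes [mean_step] per letter; once this is subtracted, the increment is at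
    most [mean_step] in absolute value. *)
Lemma lifted_base_step n : lifted n o <= lifted n.+1 o <= lifted n o + 2 * mean_step.
Proof.
have tri k t : D t <= D (k :: t) + d (gs k o) o /\ D (k :: t) <= D t + d (gs k o) o.
  have := dist_triangle dm (gs k o) (gs k (act t o)) o.
  have := dist_triangle dm (gs k (act t o)) (gs k o) o.
  rewrite gsd.
  have := dist_triangle dm o (gs k (act t o)) (gs k o).
  by rewrite gsd /= (distC dm o (gs k o)); lra.
have l0 : (0 <= (lifted n o)%:E)%E by rewrite lee_fin lifted_ge0.
apply/andP; split; rewrite -lee_fin.
  rewrite -(E1_cst w_ge0 w_sum1 l0) -lifted_rec.
  apply: le_E1 => // k; rewrite -Ex_horo_cons -Ex_lifted.
  apply: le_Ex => // t _; first by rewrite lee_fin.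
  rewrite lee_fin !horo_o /total_step big_cons; have [? _] := tri k t.
  by lra.
rewrite EFinD EFinM -E1_mean_step -(E1_cst w_ge0 w_sum1 l0) -lifted_rec.
rewrite -E1Z//; last by move=> k; rewrite lee_fin dist_ge0.
rewrite -(E1D w_ge0)//; last by move=> k; rewrite -EFinM lee_fin mulr_ge0// dist_ge0.
apply: le_E1 => // k; first by rewrite lee_fin addr_ge0// lifted_ge0.
rewrite -Ex_horo_cons -Ex_lifted.
have d0 : (0 <= 2%:E * (d (gs k o) o)%:E)%E by rewrite -EFinM lee_fin mulr_ge0// dist_ge0.
rewrite -(Ex_cst w_ge0 w_sum1 n d0) -(ExD w_ge0)//; last by move=> s; rewrite lee_fin.
apply: le_Ex => // t _; first by rewrite lee_fin.
rewrite -EFinM -EFinD lee_fin !horo_o /total_step big_cons; have [_ ?] := tri k t.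
by lra.
Qed.

Local Notation c := (step_constant alpha m (mean_step + G)).

(** An Azuma argument, by induction on the first letter: [lifted n y - n%:R * mean_step] is the mean
    of [horo y]. Learning the first letter changes the mean by an amount controlled by the length of
    that letter, because [lifted n] depends on its base point only up to [G]. *)
Lemma expR_horo_le l : `|l| <= alpha / 6 -> forall n y,
  (Ex w n (fun s => (expR (l * (horo y s - (lifted n y - n%:R * mean_step))))%:E) <=
   ((1 + c * l ^+ 2) ^+ n)%:E)%E.
Proof.
move=> la; have G0 : 0 <= G by rewrite mulr_ge0// divr_ge0 ?A_ge0// ltW.
have m0 := mean_step_ge0.
have c0 : 0 <= c by exact: (step_constant_ge0 _ w_ge0 alpha_gt0 um).
have c1 : 0 <= 1 + c * l ^+ 2 by rewrite addr_ge0// mulr_ge0// sqr_ge0.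
elim=> [|n IH] y.
  rewrite /= expr0 lee_fin.
  suff -> : lifted 0 y = 0 by rewrite /horo /= subrr !(mul0r, subr0, mulr0) expR0.
  by rewrite /lifted /rex /= /horo /total_step big_nil /= subrr addr0.
(* [U k - V k] is the change of mean due to the letter [k]; both terms are nonnegative, with mean
   [lifted n.+1 y + mean_step]. *)
pose U k := lifted n (gi k y) + (d o (gi k y) - d o y + d (gs k o) o) + mean_step.
pose V k := lifted n.+1 y + d (gs k o) o.
have split_expR k t : expR (l * (horo y (k :: t) - (lifted n.+1 y - n.+1%:R * mean_step))) =
    expR (l * (U k - V k)) *
    expR (l * (horo (gi k y) t - (lifted n (gi k y) - n%:R * mean_step))).
  rewrite -expRD horo_cons /U /V -[n.+1%:R]natr1; congr expR; ring.
rewrite /= (eq_E1 w (g := fun k => (expR (l * (U k - V k)))%:E *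
  Ex w n (fun t => (expR (l * (horo (gi k y) t - (lifted n (gi k y) - n%:R * mean_step))))%:E))%E);
  last first.
  move=> k; rewrite -ExZ ?expR_ge0//.
  by apply: eq_Ex => t _; rewrite split_expR EFinM.
apply: (@le_trans _ _ (E1 w (fun k => ((1 + c * l ^+ 2) ^+ n)%:E *
    (expR (l * (U k - V k)))%:E)%E)).
  apply: le_E1 => // k.
    by rewrite mule_ge0 ?lee_fin ?expR_ge0//; apply: Ex_ge0.
  by rewrite muleC; apply: lee_wpmul2r; rewrite ?lee_fin ?expR_ge0.
rewrite E1Z ?exprn_ge0//.
rewrite (exprSr _ n) EFinM; apply: lee_wpmul2l; first by rewrite lee_fin exprn_ge0.
apply: (expR_centered_step w_ge0 w_sum1 _ alpha_gt0 _ um la (z := lifted n.+1 y + mean_step)).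
- by move=> k; exact: dist_ge0.
- by rewrite addr_ge0.
- by move=> k; apply: addr_ge0 => //; apply: addr_ge0; [exact: lifted_ge0|exact: cocycle_ge0].
- by move=> k; rewrite /V addr_ge0 ?lifted_ge0 ?dist_ge0.
- move=> k; have := lifted_base_step n; have := lifted_close n (gi k y).
  have := lifted_close n.+1 y; have := horo_cocycle k y; have := dist_ge0 dm (gs k o) o.
  rewrite !ler_norml /U /V => ? /andP[? ?] /andP[? ?] /andP[? ?] /andP[? ?].
  by apply/andP; split; lra.
- under eq_E1 do rewrite EFinD.
  rewrite (E1D w_ge0) => [|k|k]; first by rewrite lifted_rec E1_cst.
    by rewrite lee_fin addr_ge0// lifted_ge0.
  by rewrite lee_fin.
- under eq_E1 do rewrite EFinD.
  rewrite (E1D w_ge0) => [|k|k]; last by rewrite lee_fin dist_ge0.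
    by rewrite E1_mean_step E1_cst// lee_fin lifted_ge0.
  by rewrite lee_fin lifted_ge0.
Qed.

Lemma Ex_total_step n : (Ex w n (fun s => (step s)%:E) = (n%:R * mean_step)%:E)%E.
Proof.
elim: n => [|n IH]; first by rewrite /= /total_step big_nil mul0r.
have n0 : (0 <= (n%:R * mean_step)%:E)%E by rewrite lee_fin mulr_ge0// mean_step_ge0.
rewrite -natr1 mulrDl mul1r addrC EFinD -E1_mean_step -(E1_cst w_ge0 w_sum1 n0).
rewrite -(E1D w_ge0) => [|k|k] //; last by rewrite lee_fin dist_ge0.
apply: eq_E1 => k; rewrite -IH.
have d0 : (0 <= (d (gs k o) o)%:E)%E by rewrite lee_fin dist_ge0.
rewrite -[X in (X + _)%E](Ex_cst w_ge0 w_sum1 n d0) -(ExD w_ge0)//; last first.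
  by move=> s; rewrite lee_fin step_ge0.
by apply: eq_Ex => t _; rewrite -EFinD /total_step big_cons.
Qed.

Lemma lifted_base n : lifted n o = f n + n%:R * mean_step.
Proof.
apply: EFin_inj; rewrite EFinD -Ex_dist -Ex_total_step -Ex_lifted -(ExD w_ge0).
- by apply: eq_Ex => s _; rewrite horo_o EFinD.
- by move=> s; rewrite lee_fin dist_ge0.
- by move=> s; rewrite lee_fin step_ge0.
Qed.

(** At the base point [horo] is the distance itself, and replacing its mean by [n%:R * b] costs at
    most [G] times [|l|] in the exponent. *)
Lemma dist_subgaussian b l n : (forall n, n%:R * b <= f n <= n%:R * b + G) ->
  `|l| <= alpha / 6 ->
  (Ex w n (fun s => (expR (l * (D s - n%:R * b)))%:E) <=
   (expR (G * `|l| + c * l ^+ 2 * n%:R))%:E)%E.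
Proof.
move=> fb la; have /andP[fb1 fb2] := fb n.
apply: (@le_trans _ _ (Ex w n (fun s => (expR (G * `|l|))%:E *
    (expR (l * (horo o s - (lifted n o - n%:R * mean_step))))%:E)%E)).
  apply: le_Ex => // s _.
  rewrite -EFinM -expRD lee_fin ler_expR horo_o lifted_base addrK.
  have : l * (f n - n%:R * b) <= G * `|l|.
    rewrite mulrC (le_trans (ler_norm _))// normrM ger0_norm ?subr_ge0//.
    by rewrite ler_wpM2r// lerBlDl.
  by lra.
rewrite ExZ ?expR_ge0//.
rewrite expRD EFinM; apply: lee_wpmul2l; first by rewrite lee_fin expR_ge0.
apply: (le_trans (expR_horo_le la n o)); rewrite lee_fin expRM_natr.
rewrite lerXn2r ?nnegrE ?expR_ge0 ?expR_ge1Dx//.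
have := expR_horo_le la 1 o; rewrite expr1 -lee_fin; apply: le_trans.
by apply: Ex_ge0.
Qed.

End DistanceMoments.

(** * Almost multiplicativity of the centered Laplace transform *)

(** The distance and the Gromov product of a word are dependent, so the product given by the mean
    value inequality is split into a sum of squares. Separate moments then suffice, at the price of
    the doubled exponent [2 * l]. *)
Lemma expR_shift_le {R : realType} (a l g x : R) : 0 < a -> 0 <= g -> `|l| <= a / 8 ->
  `|expR (l * x) - expR (l * (x - 2 * g))| <=
  `|l| * (32 / a ^+ 2 * expR (a * g) + expR (2 * l * x)).
Proof.
move=> a0 g0 la.
have l0 := normr_ge0 l.
set u := l * x; set v := l * (x - 2 * g).
have uv : `|u - v| = 2 * `|l| * g.
  have -> : u - v = 2 * l * g by rewrite /u /v; ring.
  by rewrite !normrM (ger0_norm g0) ger0_norm.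
pose h := expR (2 * `|l| * g).
have h1 : 1 <= h by rewrite -expR0 ler_expR !mulr_ge0.
have eu := expR_gt0 u; have ev := expR_gt0 v.
have vu : expR v <= expR u * h.
  by rewrite -expRD ler_expR; have := ler_norm (v - u); rewrite distrC uv; lra.
have main : `|expR u - expR v| <= 2 * `|l| * g * (expR u * h).
  have H1 := expR_tangent v u; have H2 := expR_tangent u v.
  have lg0 : 0 <= 2 * `|l| * g by rewrite !mulr_ge0.
  have up1 : (u - v) * expR u <= 2 * `|l| * g * (expR u * h).
    rewrite -uv (le_trans (_ : _ <= `|u - v| * expR u))//.
      by rewrite ler_wpM2r ?(ltW eu)// ler_norm.
    by rewrite ler_wpM2l// ler_peMr// ltW.
  have up2 : (v - u) * expR v <= 2 * `|l| * g * (expR u * h).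
    rewrite -uv (le_trans (_ : _ <= `|u - v| * expR v))//.
      by rewrite ler_wpM2r ?(ltW ev)// distrC ler_norm.
    by rewrite ler_wpM2l.
  by rewrite ler_norml; apply/andP; split; lra.
apply: (le_trans main).
have sq : (2 * g * h) ^+ 2 <= 32 / a ^+ 2 * expR (a * g).
  have := sqr_le_expR (_ : 0 < a / 2) g0; rewrite divr_gt0// => /(_ isT) H.
  have hh : h ^+ 2 <= expR (a / 2 * g).
    rewrite -expRM_natl ler_expR; nra.
  have -> : 32 / a ^+ 2 * expR (a * g) =
      4 * (2 / (a / 2) ^+ 2 * expR (a / 2 * g)) * expR (a / 2 * g).
    have -> : a * g = a / 2 * g + a / 2 * g by field.
    by rewrite expRD; field; rewrite gt_eqF.
  rewrite exprMn ler_pM ?sqr_ge0// exprMn; lra.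
have -> : 2 * `|l| * g * (expR u * h) = `|l| * (2 * g * h * expR u) by ring.
rewrite ler_wpM2l//.
have -> : expR (2 * l * x) = expR u ^+ 2 by rewrite -expRM_natl mulrA.
have := sqr_ge0 (2 * g * h - expR u); nra.
Qed.

Section AlmostMultiplicative.
Context {R : realType} {X : Type} (d : X -> X -> R) (o : X).
Context (gs gi : nat -> X -> X) (w : nat -> R) (alpha m a A b : R).
Hypothesis dm : is_metric d.
Hypothesis gsd : forall k x y, d (gs k x) (gs k y) = d x y.
Hypothesis giK : forall k, cancel (gi k) (gs k).
Hypothesis w_ge0 : forall k, 0 <= w k.
Hypothesis w_sum1 : (\sum_(0 <= k <oo) (w k)%:E = 1)%E.
Hypothesis alpha_gt0 : 0 < alpha.
Hypothesis um : (E1 w (fun k => (expR (alpha * d (gs k o) o))%:E) = m%:E)%E.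
Hypothesis a_gt0 : 0 < a.
Hypothesis tail : forall n y,
  (Ex w n (fun s => (expR (a * gromov_product d o y (act gs s o)))%:E) <= A%:E)%E.

Local Notation gp := (gromov_product d o).
Local Notation act := (act gs).
Local Notation actV := (actV gi).
Local Notation D s := (d (act s o) o).
Local Notation G := (2 * (A / a)).
Local Notation c := (step_constant alpha m (mean_step d o gs w + G)).

Hypothesis bP : forall n, n%:R * b <= rex w n (fun s => D s) <= n%:R * b + G.

Definition phi n l : R := rex w n (fun s => expR (l * (D s - n%:R * b))).

Let A_ge0' : 0 <= A := A_ge0 tail.

Let G_ge0 : 0 <= G. Proof. by rewrite mulr_ge0// divr_ge0// ltW. Qed.

Let c_ge0 : 0 <= c. Proof. exact: (step_constant_ge0 _ w_ge0 alpha_gt0 um). Qed.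

Lemma Ex_phi_le n l : `|l| <= alpha / 6 ->
  (Ex w n (fun s => (expR (l * (D s - n%:R * b)))%:E) <=
   (expR (G * `|l| + c * l ^+ 2 * n%:R))%:E)%E.
Proof.
by move=> la; exact: (dist_subgaussian dm gsd giK w_ge0 w_sum1 alpha_gt0 um a_gt0 tail).
Qed.

Lemma Ex_phi n l : `|l| <= alpha / 6 ->
  (Ex w n (fun s => (expR (l * (D s - n%:R * b)))%:E) = (phi n l)%:E)%E.
Proof.
move=> la; rewrite /phi /rex fineK// ge0_fin_numE; last exact: Ex_ge0.
exact: le_lt_trans (Ex_phi_le n la) (ltry _).
Qed.

Lemma phi_ge0 n l : 0 <= phi n l.
Proof. by apply: (rex_ge0 w_ge0) => s; exact: expR_ge0. Qed.

Definition phi_bound := expR (G * (alpha / 6) + 8 * c).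

Lemma phi_le n l : `|l| <= alpha / 6 -> l ^+ 2 * n%:R <= 8 -> phi n l <= phi_bound.
Proof.
move=> la ln; rewrite -lee_fin -Ex_phi// (le_trans (Ex_phi_le n la))//.
rewrite lee_fin ler_expR lerD ?ler_wpM2l// -mulrA (mulrC 8) ler_wpM2l//.
Qed.

Definition mult_error := 32 / a ^+ 2 * A + phi_bound.

Lemma mult_error_ge0 : 0 <= mult_error.
Proof.
by rewrite addr_ge0 ?expR_ge0// mulr_ge0// divr_ge0// exprn_ge0// ltW.
Qed.

(** The thresholds [alpha / 12] and 2 are those of [phi_le] read at [2 * l], the exponent left by
    [expR_shift_le]. *)
Lemma phi_horo n l y : `|l| <= alpha / 12 -> `|l| <= a / 8 -> l ^+ 2 * n%:R <= 2 ->
  (Ex w n (fun s => (expR (l * (horo d o gs y s - n%:R * b)))%:E)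
     <= (phi n l + `|l| * mult_error)%:E)%E /\
  ((phi n l)%:E <= Ex w n (fun s => (expR (l * (horo d o gs y s - n%:R * b)))%:E)
     + (`|l| * mult_error)%:E)%E.
Proof.
move=> la1 la2 ln.
have la : `|l| <= alpha / 6 by have := alpha_gt0; lra.
have l2a : `|2 * l| <= alpha / 6 by rewrite normrM ger0_norm//; lra.
have K0 : 0 <= 32 / a ^+ 2 by rewrite divr_ge0// exprn_ge0// ltW.
pose err s := 32 / a ^+ 2 * expR (a * gp y (act s o)) + expR (2 * l * (D s - n%:R * b)).
have err0 s : 0 <= err s by rewrite addr_ge0 ?expR_ge0// mulr_ge0// expR_ge0.
have point s : `|expR (l * (D s - n%:R * b)) - expR (l * (horo d o gs y s - n%:R * b))|
    <= `|l| * err s.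
  have := expR_shift_le (D s - n%:R * b) a_gt0 (gp_ge0 o dm y (act s o)) la2.
  rewrite (_ : D s - n%:R * b - 2 * gp y (act s o) = horo d o gs y s - n%:R * b)//.
  by rewrite -(horo_gp o gs dm y s); ring.
have Eerr : (Ex w n (fun s => (`|l| * err s)%:E) <= (`|l| * mult_error)%:E)%E.
  rewrite EFinM; under eq_Ex do rewrite EFinM.
  rewrite ExZ//.
  apply: lee_wpmul2l; first by rewrite lee_fin.
  rewrite /err; under eq_Ex do rewrite EFinD EFinM.
  rewrite (ExD w_ge0) => [|s|s]; [|by rewrite -EFinM lee_fin mulr_ge0 ?expR_ge0|by rewrite lee_fin expR_ge0].
  rewrite ExZ// EFinD; apply: leeD.
    by rewrite (EFinM (32 / a ^+ 2) A); apply: lee_wpmul2l; rewrite ?lee_fin ?tail.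
  rewrite Ex_phi// lee_fin phi_le// exprMn; lra.
split.
  rewrite EFinD -Ex_phi// (le_trans _ (leeD2l _ Eerr))// -(ExD w_ge0)//; last first.
    by move=> s; rewrite lee_fin mulr_ge0.
  apply: le_Ex => // s _; rewrite -EFinD lee_fin.
  by have := point s; rewrite ler_norml => /andP[? ?]; lra.
rewrite -Ex_phi// (le_trans _ (leeD2l _ Eerr))// -(ExD w_ge0)//; last first.
  by move=> s; rewrite lee_fin mulr_ge0.
apply: le_Ex => // s _; rewrite -EFinD lee_fin.
by have := point s; rewrite ler_norml => /andP[? ?]; lra.
Qed.

(** Given the first [k] letters [s], the others contribute [horo] at [actV s o]. Since [phi_horo] is
    uniform in that point, [k] is unrestricted. *)
Lemma phi_almost_mult k n l : `|l| <= alpha / 12 -> `|l| <= a / 8 -> l ^+ 2 * n%:R <= 2 ->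
  phi k l * (phi n l - `|l| * mult_error) <= phi (k + n) l
    <= phi k l * (phi n l + `|l| * mult_error).
Proof.
move=> la1 la2 ln.
have la : `|l| <= alpha / 6 by have := alpha_gt0; lra.
have e0 : 0 <= `|l| * mult_error by rewrite mulr_ge0// mult_error_ge0.
pose psi s := Ex w n (fun t => (expR (l * (horo d o gs (actV s o) t - n%:R * b)))%:E).
have psi0 s : (0 <= psi s)%E by apply: Ex_ge0.
have E : ((phi (k + n) l)%:E =
    Ex w k (fun s => (expR (l * (D s - k%:R * b)))%:E * psi s)%E)%E.
  rewrite -Ex_phi// Ex_cat; apply: eq_Ex => s _; rewrite -ExZ ?expR_ge0//.
  apply: eq_Ex => t _; rewrite -EFinM -expRD (dist_cat o gsd giK) natrD.
  by congr (expR _)%:E; ring.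
apply/andP; split; rewrite -lee_fin.
  rewrite mulrBr EFinB leeBlDr// E.
  rewrite !(mulrC (phi k l)) (EFinM (phi n l)) (EFinM (`|l| * mult_error)).
  rewrite -(Ex_phi k)// -!ExZ ?phi_ge0//.
  rewrite -(ExD w_ge0); last 2 first.
  - by move=> s; rewrite mule_ge0.
  - by move=> s; rewrite -EFinM lee_fin mulr_ge0// expR_ge0.
  apply: le_Ex => // s _; first by rewrite -EFinM lee_fin mulr_ge0// ?phi_ge0 ?expR_ge0.
  rewrite muleC (muleC (`|l| * mult_error)%:E) -ge0_muleDr//.
  apply: lee_wpmul2l => //.
  by have [_] := phi_horo (actV s o) la1 la2 ln.
rewrite E (mulrC (phi k l)) (EFinM (phi n l + _)) -(Ex_phi k)// -ExZ//; last by rewrite addr_ge0// phi_ge0.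
apply: le_Ex => // s _; first by rewrite mule_ge0.
rewrite muleC; apply: lee_wpmul2r => //.
by have [] := phi_horo (actV s o) la1 la2 ln.
Qed.

Lemma phi0 l : phi 0 l = 1.
Proof. by rewrite /phi /rex /= (distxx dm) mul0r subr0 mulr0 expR0. Qed.

Lemma phi_pow N j l : `|l| <= alpha / 12 -> `|l| <= a / 8 -> l ^+ 2 * N%:R <= 2 ->
  `|l| * mult_error <= phi N l ->
  (phi N l - `|l| * mult_error) ^+ j <= phi (j * N) l
    <= (phi N l + `|l| * mult_error) ^+ j.
Proof.
move=> la1 la2 lN lphi.
have e0 : 0 <= `|l| * mult_error by rewrite mulr_ge0// mult_error_ge0.
elim: j => [|j /andP[IH1 IH2]]; first by rewrite mul0n phi0 !expr0 lexx.
rewrite mulSn addnC; have /andP[h1 h2] := phi_almost_mult (j * N) la1 la2 lN.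
rewrite !exprSr; apply/andP; split.
  by rewrite (le_trans _ h1)// ler_wpM2r// subr_ge0.
by rewrite (le_trans h2)// ler_wpM2r// addr_ge0// phi_ge0.
Qed.

End AlmostMultiplicative.

(** * From the random walk to words *)

Section WalkExpectation.
Context {dT : measure_display} {T : measurableType dT} {R : realType}.
Context (P : probability T R) (w : nat -> R) (K : nat -> T -> nat).
Hypothesis w_ge0 : forall k, 0 <= w k.
Hypothesis iid : iid_indices P w K.
Implicit Types s : seq nat.

(* The last letter drawn comes first, as the corresponding isometry is
   applied last. *)
Definition segment m n t : seq nat := rev [seq K i t | i <- iota m n].
Local Notation word := (segment 0).

Lemma segmentS m n t : segment m n.+1 t = rcons (segment m.+1 n t) (K m t).
Proof. by rewrite /segment /= rev_cons. Qed.

Lemma wordS n t : word n.+1 t = K n t :: word n t.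
Proof. by rewrite /segment -addn1 iotaD map_cat rev_cat. Qed.

Lemma size_segment m n t : size (segment m n t) = n.
Proof. by rewrite size_rev size_map size_iota. Qed.

Lemma walk_word {X : Type} (gs : nat -> X -> X) (o : X) n t :
  walk gs K o n t = act gs (word n t) o.
Proof. by elim: n => [//|n IH]; rewrite wordS /= IH. Qed.

Lemma measurable_segment m s : measurable [set t | segment m (size s) t = s].
Proof.
elim/last_ind: s m => [|s k IH] m.
  by rewrite (_ : [set t | _] = setT)//; apply/seteqP; split.
rewrite (_ : [set t | _] = [set t | K m t = k] `&` [set t | segment m.+1 (size s) t = s]).
  by apply: measurableI; [exact: iid.1|exact: IH].
apply/seteqP; split => t /=; rewrite size_rcons segmentS; first by move=> /rcons_inj[].
by move=> [-> ->].
Qed.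

Lemma measurable_fun_word n (H : seq nat -> \bar R) D : measurable D ->
  measurable_fun D (fun t => H (word n t) : \bar R).
Proof.
move=> mD; apply: (measurable_funS measurableT) => //.
move=> _ B mB; rewrite setTI.
rewrite (_ : _ @^-1` B = \bigcup_s
    (if `[< size s = n /\ B (H s) >] then [set t | word n t = s] else set0)).
  apply: countable_bigcupT_measurable => // s.
  case: asboolP => // -[<- _]; exact: measurable_segment.
apply/seteqP; split => t /=.
  move=> Bt; exists (word n t) => //; case: asboolP => // -[]; split=> //.
  by rewrite size_segment.
by move=> [s _]; case: asboolP => // -[_ Bs] /= ->.
Qed.

Lemma probability_word s :
  P [set t | word (size s) t = s] = (weight w s)%:E.
Proof.
have := iid.2 (size s) (nth 0%N (rev s)).
rewrite (_ : [set t | forall i, _] = [set t | word (size s) t = s]).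
  move=> ->; congr _%:E; rewrite /weight.
  rewrite -(big_mkord xpredT (fun i => w (nth 0%N (rev s) i))) -{1}(size_rev s).
  by rewrite -(big_nth 0%N xpredT w); apply: perm_big; rewrite perm_rev.
apply/seteqP; split => t /=.
  move=> Kt; rewrite /segment -[RHS]revK; congr rev.
  apply: (@eq_from_nth _ 0%N); first by rewrite size_map size_iota size_rev.
  move=> i; rewrite size_map size_iota => ilt.
  by rewrite (nth_map 0%N) ?size_iota// nth_iota// Kt.
move=> E i ilt; rewrite -E revK (nth_map 0%N) ?size_iota// nth_iota//.
Qed.

(** Induction on the number of free letters, the latest of them being fixed next, as in [Ex]. At
    [m = 0] the whole word is fixed and [probability_word] applies. *)
Lemma integral_cylinder (H : seq nat -> \bar R) m s : (forall s, 0 <= H s)%E ->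
  (\int[P]_(t in [set t | segment m (size s) t = s]) H (s ++ word m t) =
   (weight w s)%:E * Ex w m (fun t => H (s ++ t)))%E.
Proof.
move=> H0; elim: m s => [|m IH] s.
  rewrite (eq_integral (cst (H s))); last by move=> t _; rewrite cats0.
  rewrite integral_cst; last exact: measurable_segment.
  by rewrite /= cats0 muleC; congr (_ * _)%E; exact: probability_word.
pose F k := [set t | segment m (size (rcons s k)) t = rcons s k].
have mF k : measurable (F k) by exact: measurable_segment.
have FP k t : F k t <-> segment m.+1 (size s) t = s /\ K m t = k.
  rewrite /F /= size_rcons segmentS; split; first by move=> /rcons_inj[].
  by move=> [-> ->].
have FE : [set t | segment m.+1 (size s) t = s] = \bigcup_k F k.
  apply/seteqP; split => t /=; first by move=> E; exists (K m t) => //; apply/FP.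
  by move=> [k _ /FP[]].
rewrite FE ge0_integral_bigcup//; last 2 first.
- apply: (measurable_fun_word m.+1 (fun s' => H (s ++ s'))).
  exact: bigcup_measurable.
- apply/trivIsetP => i j _ _ ij; apply/seteqP; split=> // t [/FP[_ Ki] /FP[_ Kj]].
  by move: ij; rewrite -Ki -Kj eqxx.
rewrite /= /E1 -nneseriesZl; last first.
  by move=> k _; rewrite mule_ge0 ?lee_fin//; apply: Ex_ge0.
apply: eq_eseriesr => k _.
rewrite muleA -EFinM (_ : weight w s * w k = weight w (rcons s k)); last first.
  by rewrite /weight -cats1 big_cat /= big_seq1.
under [in RHS]eq_Ex do rewrite -cat_rcons.
rewrite -IH; apply: eq_integral => t; rewrite inE => /FP[_ Kt].
by rewrite cat_rcons wordS Kt.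
Qed.

Lemma integral_word (H : seq nat -> \bar R) n : (forall s, 0 <= H s)%E ->
  (\int[P]_t H (word n t) = Ex w n H)%E.
Proof.
move=> H0; have := integral_cylinder n [::] H0.
rewrite /weight big_nil mul1e => <-; congr (integral _ _ _).
by apply/seteqP; split.
Qed.

End WalkExpectation.

(** * Growth rates of Laplace transforms *)

Lemma fekete {R : realType} (v : nat -> R) : (forall n, 0 <= v n) ->
  (forall n m, v (n + m)%N <= v n + v m) -> exists L : R, v n / n%:R @[n --> \oo] --> L.
Proof.
move=> v0 vsub.
have vmul k n : v (k * n)%N <= k%:R * v n + v 0%N.
  elim: k => [|k IH]; first by rewrite mul0r add0r.
  by rewrite mulSn (le_trans (vsub _ _))// -natr1; lra.
pose E := [set v n.+1 / n.+1%:R | n in [set: nat]].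
have Einf : has_inf E.
  split; first by exists (v 1%N / 1%:R), 0%N.
  by exists 0 => _ [n _ <-]; rewrite divr_ge0.
exists (inf E); apply/cvgrPdist_le => e e0.
have e20 : 0 < e / 2 by rewrite divr_gt0.
have [_ [k _ <-] Hk] := inf_adherent e20 Einf.
set C := k.+1%:R * v 1%N + 2 * v 0%N.
have C0 : 0 <= C by rewrite addr_ge0// mulr_ge0.
near=> n.
have n0 : (0 < n)%N by near: n; exact: nbhs_infty_gt.
have n0R : 0 < n%:R :> R by rewrite ltr0n.
have lo : inf E <= v n / n%:R.
  by apply: ge_inf; [exact: Einf.2|exists n.-1 => //; rewrite prednK].
have up : v n <= n%:R * (v k.+1 / k.+1%:R) + C.
  rewrite {1}(divn_eq n k.+1) (le_trans (vsub _ _))//.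
  have h1 := vmul (n %/ k.+1)%N k.+1; have := vmul (n %% k.+1)%N 1%N.
  rewrite muln1 => h2.
  have h3 : (n %% k.+1)%:R * v 1%N <= k.+1%:R * v 1%N.
    by rewrite ler_wpM2r// ler_nat ltnW// ltn_mod.
  have h4 : (n %/ k.+1)%:R * v k.+1 <= n%:R * (v k.+1 / k.+1%:R).
    by rewrite mulrA ler_pdivlMr// mulrAC -natrM ler_wpM2r// ler_nat leq_trunc_div.
  rewrite (le_trans (lerD h1 h2))// /C; move: h3 h4.
  move: (n%:R * (v k.+1 / k.+1%:R)) ((n %/ k.+1)%:R * v k.+1) => x y.
  move: ((n %% k.+1)%:R * v 1%N) (k.+1%:R * v 1%N) => x' y'; lra.
have Cn : C / n%:R <= e / 2.
  rewrite ler_pdivrMr// -ler_pdivrMl//.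
  by near: n; exact: nbhs_infty_ger.
have : v n / n%:R <= v k.+1 / k.+1%:R + C / n%:R.
  by rewrite ler_pdivrMr// mulrDl divfK ?gt_eqF// mulrC.
rewrite distrC ger0_norm ?subr_ge0//; move: Hk Cn.
by move: (v n / n%:R) (v k.+1 / k.+1%:R) (C / n%:R) => x y z; lra.
Unshelve. all: by end_near.
Qed.

(** The two cases serve the two signs of [l]: subadditivity of the distance makes its Laplace
    transform submultiplicative for [0 <= l] and supermultiplicative for [l < 0]. *)
Lemma log_growth_cvg {R : realType} (z : nat -> R) : (forall n, 0 < z n) ->
  ((forall n, 1 <= z n) /\ forall n m, z (n + m)%N <= z n * z m) \/
  ((forall n, z n <= 1) /\ forall n m, z n * z m <= z (n + m)%N) ->
  exists L : R, ln (z n) / n%:R @[n --> \oo] --> L.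
Proof.
move=> z0 [[z1 zsub]|[z1 zsup]].
  apply: fekete => [n|n m]; first by rewrite ln_ge0.
  by rewrite -lnM ?posrE// ler_ln ?posrE// mulr_gt0.
have [|n m|L vL] := @fekete _ (fun n => - ln (z n)).
- by move=> n; rewrite oppr_ge0 ln_le0.
- by rewrite -opprD lerN2 -lnM ?posrE// ler_ln ?posrE// mulr_gt0.
exists (- L); rewrite (_ : (fun n => _) = (fun n => - (- ln (z n) / n%:R))).
  exact: cvgN.
by apply/funext => n; rewrite mulNr opprK.
Qed.

Lemma log_growth_bounds {R : realType} (z : nat -> R) (L p q : R) N :
  (0 < N)%N -> ln (z n) / n%:R @[n --> \oo] --> L -> 0 < p ->
  (forall j, p ^+ j <= z (j * N)%N <= q ^+ j) -> ln p <= N%:R * L <= ln q.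
Proof.
move=> N0 zL p0 pq; have N0R : 0 < N%:R :> R by rewrite ltr0n.
have q0 : 0 < q.
  by have /andP[h1 h2] := pq 1%N; rewrite expr1 in h2 h1; rewrite (lt_le_trans p0)// (le_trans h1).
have close e : 0 < e -> ln p / N%:R <= L + e /\ L - e <= ln q / N%:R.
  move=> e0; move/cvgrPdist_le: zL => /(_ _ e0)[M _ HM].
  have jM : (M <= M.+1 * N)%N by rewrite (leq_trans (leqnSn M))// leq_pmulr.
  have /= := HM _ jM; rewrite ler_norml.
  have jN0 : 0 < (M.+1 * N)%:R :> R by rewrite ltr0n muln_gt0.
  have /andP[h1 h2] := pq M.+1.
  have pj : 0 < p ^+ M.+1 by rewrite exprn_gt0.
  have z0 : 0 < z (M.+1 * N)%N by rewrite (lt_le_trans pj).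
  have e1 x : 0 < x -> ln (x ^+ M.+1) / (M.+1 * N)%:R = ln x / N%:R.
    by move=> x0; rewrite lnXn// natrM -[ln x *+ _]mulr_natr invfM mulrA mulfK.
  have : ln p / N%:R <= ln (z (M.+1 * N)%N) / (M.+1 * N)%:R.
    by rewrite -e1// ler_pM2r ?invr_gt0// ler_ln ?posrE.
  have : ln (z (M.+1 * N)%N) / (M.+1 * N)%:R <= ln q / N%:R.
    by rewrite -e1// ler_pM2r ?invr_gt0// ler_ln ?posrE// exprn_gt0.
  move: (ln p / N%:R) (ln q / N%:R) (ln (z (M.+1 * N)%N) / _) => x y t.
  by move=> ? ? /andP[? ?]; lra.
apply/andP; split; rewrite mulrC.
  by rewrite -ler_pdivrMr//; apply/ler_addgt0Pr => e /close[].
by rewrite -ler_pdivlMr//; apply/ler_addgt0Pr => e /close[_]; rewrite lerBlDr.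
Qed.

Lemma Ex_gt0 {R : realType} (w : nat -> R) n (F : seq nat -> \bar R) :
  (forall k, 0 <= w k) -> (\sum_(0 <= k <oo) (w k)%:E = 1)%E ->
  (forall s, 0 < F s)%E -> (0 < Ex w n F)%E.
Proof.
move=> w0 w1; elim: n F => [|n IH] F F0 //=.
have [k wk] := pos_weight w0 w1.
have := E1_pt w0 k (f := fun k => Ex w n (fun t => F (k :: t))) (fun k => ltW (IH _ (fun s => F0 _))).
by apply: lt_le_trans; rewrite mule_gt0// IH.
Qed.

Section Laplace.
Context {R : realType} {X : Type} (d : X -> X -> R) (o : X).
Context (gs gi : nat -> X -> X) (w : nat -> R) (alpha m a A b : R).
Hypothesis dm : is_metric d.
Hypothesis gsd : forall k x y, d (gs k x) (gs k y) = d x y.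
Hypothesis giK : forall k, cancel (gi k) (gs k).
Hypothesis w_ge0 : forall k, 0 <= w k.
Hypothesis w_sum1 : (\sum_(0 <= k <oo) (w k)%:E = 1)%E.
Hypothesis alpha_gt0 : 0 < alpha.
Hypothesis um : (E1 w (fun k => (expR (alpha * d (gs k o) o))%:E) = m%:E)%E.
Hypothesis a_gt0 : 0 < a.
Hypothesis tail : forall n y,
  (Ex w n (fun s => (expR (a * gromov_product d o y (act gs s o)))%:E) <= A%:E)%E.

Local Notation act := (act gs).
Local Notation D s := (d (act s o) o).
Local Notation G := (2 * (A / a)).

Hypothesis bP : forall n, n%:R * b <= rex w n (fun s => D s) <= n%:R * b + G.

Local Notation phi := (phi d o gs w b).
Local Notation err := (mult_error d o gs w alpha m a A).

Definition laplace l n : R := expR (l * n%:R * b) * phi n l.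

Lemma Ex_laplace l n : `|l| <= alpha / 6 ->
  (Ex w n (fun s => (expR (l * D s))%:E) = (laplace l n)%:E)%E.
Proof.
move=> la; rewrite /laplace EFinM.
rewrite -(Ex_phi dm gsd giK w_ge0 w_sum1 alpha_gt0 um a_gt0 tail bP n la) -ExZ ?expR_ge0//.
by apply: eq_Ex => s _; rewrite -EFinM -expRD; congr (expR _)%:E; ring.
Qed.

Lemma laplace_gt0 l n : `|l| <= alpha / 6 -> 0 < laplace l n.
Proof.
move=> la; rewrite -lte_fin -Ex_laplace//; apply: Ex_gt0 => // s.
by rewrite lte_fin expR_gt0.
Qed.

Lemma dist_cat_le s t : D (s ++ t) <= D s + D t.
Proof. by rewrite (dist_cat o gsd giK) lerD2l horo_le. Qed.

Lemma laplace_cvg l : `|l| <= alpha / 6 ->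
  exists L : R, ln (laplace l n) / n%:R @[n --> \oo] --> L.
Proof.
move=> la; apply: log_growth_cvg => [n|]; first exact: laplace_gt0.
have split_Ex n k : ((laplace l n * laplace l k)%:E =
    Ex w n (fun s => Ex w k (fun t => (expR (l * (D s + D t)))%:E)))%E.
  rewrite mulrC EFinM -(Ex_laplace n la) -ExZ ?ltW ?laplace_gt0//.
  apply: eq_Ex => s _; rewrite muleC -[in LHS]Ex_laplace// -ExZ ?expR_ge0//.
  by apply: eq_Ex => t _; rewrite -EFinM -expRD mulrDr.
have [l0|l0] := leP 0 l; [left|right]; split => [n|n k].
- rewrite -lee_fin -Ex_laplace// -[leLHS](Ex_cst w_ge0 w_sum1 n lee01).
  by apply: le_Ex => // s _; rewrite lee_fin -expR0 ler_expR mulr_ge0// dist_ge0.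
- rewrite -lee_fin split_Ex -Ex_laplace// Ex_cat.
  apply: le_Ex => // s _; first exact: Ex_ge0.
  by apply: le_Ex => // t _; rewrite lee_fin ler_expR ler_wpM2l// dist_cat_le.
- rewrite -lee_fin -Ex_laplace// -[leRHS](Ex_cst w_ge0 w_sum1 n lee01).
  apply: le_Ex => // s _; rewrite lee_fin -expR0 ler_expR.
  by rewrite mulr_le0_ge0 ?(ltW l0)// dist_ge0.
- rewrite -lee_fin split_Ex -Ex_laplace// Ex_cat.
  apply: le_Ex => // s _; first exact: Ex_ge0.
  by apply: le_Ex => // t _; rewrite lee_fin ler_expR ler_wnM2l ?(ltW l0)// dist_cat_le.
Qed.

Lemma laplace_bounds (l L : R) N : `|l| <= alpha / 12 -> `|l| <= a / 8 ->
  l ^+ 2 * N%:R <= 2 -> (0 < N)%N ->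
  ln (laplace l n) / n%:R @[n --> \oo] --> L ->
  0 < phi N l - `|l| * err ->
  ln (phi N l - `|l| * err) <= N%:R * (L - l * b) <= ln (phi N l + `|l| * err).
Proof.
move=> la1 la2 lN N0 zL e0.
have err0 : 0 <= `|l| * err by rewrite mulr_ge0// (mult_error_ge0 alpha m a_gt0 tail).
have p0 : 0 < phi N l + `|l| * err by lra.
have le_err : `|l| * err <= phi N l by lra.
set E := expR (l * N%:R * b).
have : ln (E * (phi N l - `|l| * err)) <= N%:R * L <= ln (E * (phi N l + `|l| * err)).
  apply: (log_growth_bounds N0 zL) => [|j]; first by rewrite mulr_gt0 ?expR_gt0.
  rewrite !exprMn /laplace.
  have -> : expR (l * (j * N)%:R * b) = E ^+ j.
    by rewrite -expRM_natl natrM; congr expR; ring.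
  have /andP[h1 h2] := phi_pow dm gsd giK w_ge0 w_sum1 alpha_gt0 um a_gt0 tail bP j
    la1 la2 lN le_err.
  by rewrite !ler_wpM2l// exprn_ge0// expR_ge0.
by rewrite !lnM ?posrE ?expR_gt0// !expRK => /andP[h1 h2]; apply/andP; split; lra.
Qed.

End Laplace.

Lemma Lambda_walk {dT : measure_display} {T : measurableType dT} {R : realType} {X : Type}
  (d : X -> X -> R) (o : X) (gs : nat -> X -> X) (P : probability T R) (w : nat -> R)
  (K : nat -> T -> nat) (l L : R) (z : nat -> R) :
  (forall k, 0 <= w k) -> iid_indices P w K ->
  (forall n, Ex w n (fun s => (expR (l * d (act gs s o) o))%:E) = (z n)%:E)%E ->
  (forall n, 0 < z n) -> ln (z n) / n%:R @[n --> \oo] --> L ->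
  Lambda d o gs P K l = L%:E.
Proof.
move=> w0 iid zE z0 zL; rewrite /Lambda.
rewrite (_ : (fun n => _) = (fun n => (ln (z n) / n%:R)%:E)).
  by apply/cvg_lim => //; apply: cvg_EFin => //; exact: nearW.
apply/funext => n; have -> : (\int[P]_t (expR (l * d (walk gs K o n t) o))%:E = (z n)%:E)%E.
  rewrite -zE -(integral_word w0 iid)//.
  by apply: eq_integral => t _; rewrite walk_word.
by rewrite lne_EFin// -EFinM mulrC.
Qed.

(** * Truncated exponentials as test functions *)

(** Used to replace [l] by a nearby [1 / sqrt N] up to sign; the right-hand side involves only
    exponents whose moments [phi_bound] controls. *)
Lemma expR_dilate_le {R : realType} (t x : R) : 1 <= t <= 3 / 2 ->
  `|expR (t * x) - expR x| <= (t - 1) * (2 * (expR (2 * x) + expR (- (2 * x)))).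
Proof.
move=> /andP[t1 t2].
have ax0 := normr_ge0 x.
have ex2 : expR (2 * `|x|) <= expR (2 * x) + expR (- (2 * x)).
  have := expR_ge0 (2 * x); have := expR_ge0 (- (2 * x)).
  by case: (ger0P x) => _; rewrite ?mulrN; lra.
have xe : `|x| * expR (t * `|x|) <= 2 * expR (2 * `|x|).
  have h1 : `|x| <= 2 * expR (1 / 2 * `|x|).
    have h : 0 < 1 / 2 :> R by rewrite divr_gt0.
    by have := le_expR_div `|x| h; rewrite invf_div divr1 mulrC.
  have h2 : expR (t * `|x|) <= expR (3 / 2 * `|x|) by rewrite ler_expR ler_wpM2r.
  have -> : 2 * expR (2 * `|x|) = 2 * expR (1 / 2 * `|x|) * expR (3 / 2 * `|x|).
    by rewrite -mulrA -expRD; congr (_ * expR _); lra.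
  by rewrite ler_pM ?expR_ge0.
have tx : expR (t * x) <= expR (t * `|x|).
  by rewrite ler_expR ler_wpM2l ?ler_norm//; lra.
have x1 : expR x <= expR (t * `|x|).
  by rewrite ler_expR; have := ler_norm x; nra.
have h1 := expR_tangent x (t * x); have h2 := expR_tangent (t * x) x.
have t10 : 0 <= t - 1 by lra.
have b1 : (t - 1) * x * expR (t * x) <= (t - 1) * (`|x| * expR (t * `|x|)).
  rewrite -mulrA ler_wpM2l// (le_trans (_ : _ <= `|x| * expR (t * x)))//.
    by rewrite ler_wpM2r ?expR_ge0// ler_norm.
  by rewrite ler_wpM2l.
have b2 : - ((t - 1) * x * expR x) <= (t - 1) * (`|x| * expR (t * `|x|)).
  rewrite -mulrA -mulrN ler_wpM2l// -mulNr.
  rewrite (le_trans (_ : _ <= `|x| * expR x))//.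
    by rewrite ler_wpM2r ?expR_ge0// -normrN ler_norm.
  by rewrite ler_wpM2l.
have b3 : (t - 1) * (`|x| * expR (t * `|x|)) <=
    (t - 1) * (2 * (expR (2 * x) + expR (- (2 * x)))).
  by rewrite ler_wpM2l// (le_trans xe)// ler_wpM2l.
by rewrite ler_norml; apply/andP; split; lra.
Qed.

(** Uniform integrability in explicit form: the part above [M] is paid for by the exponential at
    twice the exponent. *)
Lemma expR_truncate_le {R : realType} (x M : R) : 0 < M ->
  expR x <= Num.min (expR x) M + expR (2 * x) / M.
Proof.
move=> M0; case: (leP (expR x) M) => [_|Mx].
  by rewrite lerDl divr_ge0 ?expR_ge0// ltW.
rewrite (le_trans (_ : _ <= expR (2 * x) / M)) ?lerDr ?(ltW M0)//.
by rewrite ler_pdivlMr// -mulr_natl mulr_natl expRM_natl expr2 ler_wpM2l ?expR_ge0// ltW.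
Qed.

Section Truncation.
Context {R : realType} {X : Type} (d : X -> X -> R) (o : X).
Context (gs gi : nat -> X -> X) (w : nat -> R) (alpha m a A b : R).
Hypothesis dm : is_metric d.
Hypothesis gsd : forall k x y, d (gs k x) (gs k y) = d x y.
Hypothesis giK : forall k, cancel (gi k) (gs k).
Hypothesis w_ge0 : forall k, 0 <= w k.
Hypothesis w_sum1 : (\sum_(0 <= k <oo) (w k)%:E = 1)%E.
Hypothesis alpha_gt0 : 0 < alpha.
Hypothesis um : (E1 w (fun k => (expR (alpha * d (gs k o) o))%:E) = m%:E)%E.
Hypothesis a_gt0 : 0 < a.
Hypothesis tail : forall n y,
  (Ex w n (fun s => (expR (a * gromov_product d o y (act gs s o)))%:E) <= A%:E)%E.

Local Notation act := (act gs).
Local Notation D s := (d (act s o) o).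
Local Notation G := (2 * (A / a)).

Hypothesis bP : forall n, n%:R * b <= rex w n (fun s => D s) <= n%:R * b + G.

Local Notation phi := (phi d o gs w b).
Local Notation Kb := (phi_bound d o gs w alpha m a A).

Definition truncated k M n : R :=
  rex w n (fun s => Num.min (expR (k * (D s - n%:R * b))) M).

Lemma Ex_min_expR (F : seq nat -> R) M n : 0 < M ->
  (Ex w n (fun s => (Num.min (expR (F s)) M)%:E) =
   (rex w n (fun s => Num.min (expR (F s)) M))%:E)%E.
Proof.
move=> M0; have ge0 s : 0 <= Num.min (expR (F s)) M by rewrite le_min expR_ge0 ltW.
rewrite /rex fineK// ge0_fin_numE; last first.
  by apply: Ex_ge0 => // s _; rewrite lee_fin.
have M0' : (0 <= M%:E)%E by rewrite lee_fin ltW.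
apply: (@le_lt_trans _ _ M%:E); last exact: ltry.
rewrite -[leRHS](Ex_cst w_ge0 w_sum1 n M0').
by apply: le_Ex => // s _; rewrite lee_fin ?ge0// ge_min lexx orbT.
Qed.

Lemma Ex_truncated k M n : 0 < M ->
  (Ex w n (fun s => (Num.min (expR (k * (D s - n%:R * b))) M)%:E) =
   (truncated k M n)%:E)%E.
Proof. exact: Ex_min_expR. Qed.

Lemma phi_truncated k t M n : 1 <= t <= 3 / 2 -> 0 < M -> `|k| <= alpha / 12 ->
  k ^+ 2 * n%:R <= 2 ->
  `|phi n (t * k) - truncated k M n| <= (t - 1) * (4 * Kb) + Kb / M.
Proof.
move=> t12 M0 ka kn; have /andP[t1 t2] := t12.
have phiE := Ex_phi dm gsd giK w_ge0 w_sum1 alpha_gt0 um a_gt0 tail bP.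
have tka : `|t * k| <= alpha / 6.
  by rewrite normrM ger0_norm; have := normr_ge0 k; nra.
have k2a : `|2 * k| <= alpha / 6 by rewrite normrM ger0_norm//; lra.
have mk2a : `|- (2 * k)| <= alpha / 6 by rewrite normrN.
have k2K : phi n (2 * k) <= Kb.
  apply: (phi_le dm gsd giK w_ge0 w_sum1 alpha_gt0 um a_gt0 tail bP) => //.
  by rewrite exprMn; lra.
have mk2K : phi n (- (2 * k)) <= Kb.
  apply: (phi_le dm gsd giK w_ge0 w_sum1 alpha_gt0 um a_gt0 tail bP) => //.
  by rewrite sqrrN exprMn; lra.
have t10 : 0 <= t - 1 by lra.
pose e1 s := expR (2 * k * (D s - n%:R * b)).
pose e2 s := expR (- (2 * k) * (D s - n%:R * b)).
have Ee1 : (Ex w n (fun s => (e1 s)%:E) = (phi n (2 * k))%:E)%E := phiE _ _ k2a.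
have Ee2 : (Ex w n (fun s => (e2 s)%:E) = (phi n (- (2 * k)))%:E)%E := phiE _ _ mk2a.
have Edil : (Ex w n (fun s => ((t - 1) * 2)%:E * ((e1 s)%:E + (e2 s)%:E)) <=
    ((t - 1) * (4 * Kb))%:E)%E.
  rewrite ExZ ?mulr_ge0//; last by move=> s; rewrite -EFinD lee_fin addr_ge0 ?expR_ge0.
  rewrite (ExD w_ge0) ?Ee1 ?Ee2; last 2 first.
  - by move=> s; rewrite lee_fin expR_ge0.
  - by move=> s; rewrite lee_fin expR_ge0.
  rewrite -EFinD -EFinM lee_fin.
  rewrite -mulrA ler_wpM2l//; lra.
have dil s : `|expR (t * k * (D s - n%:R * b)) - expR (k * (D s - n%:R * b))| <=
    (t - 1) * 2 * (e1 s + e2 s).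
  have := expR_dilate_le (k * (D s - n%:R * b)) t12.
  by rewrite /e1 /e2 mulNr !mulrA.
have tr0 s : 0 <= Num.min (expR (k * (D s - n%:R * b))) M.
  by rewrite le_min expR_ge0 ltW.
have e0 s : 0 <= (t - 1) * 2 * (e1 s + e2 s).
  by rewrite mulr_ge0 ?mulr_ge0// addr_ge0 ?expR_ge0.
have Mi0 : 0 <= M^-1 by rewrite invr_ge0 ltW.
have EM : (Ex w n (fun s => (M^-1)%:E * (e1 s)%:E) <= (Kb / M)%:E)%E.
  rewrite ExZ//; last by move=> s; rewrite lee_fin expR_ge0.
  by rewrite Ee1 -EFinM lee_fin mulrC ler_wpM2r.
have Mk : 0 <= Kb / M by rewrite divr_ge0 ?expR_ge0// ltW.
rewrite ler_norml opprD; apply/andP; split.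
  suff : truncated k M n <= phi n (t * k) + (t - 1) * (4 * Kb) by lra.
  rewrite -lee_fin -Ex_truncated// EFinD -phiE// (le_trans _ (leeD2l _ Edil))//.
  rewrite -(ExD w_ge0)//.
  apply: le_Ex => // s _; first by rewrite lee_fin.
  rewrite -!(EFinD, EFinM) lee_fin.
  have := dil s; rewrite ler_norml => /andP[? _].
  by rewrite ge_min; apply/orP; left; lra.
rewrite lerBlDl -lee_fin 2!EFinD -Ex_truncated// -phiE//.
rewrite (le_trans _ (leeD2l _ (leeD Edil EM)))//.
have Me1 s : (0 <= (M^-1)%:E * (e1 s)%:E)%E.
  by rewrite -EFinM lee_fin mulr_ge0// expR_ge0.
have te s : (0 <= ((t - 1) * 2)%:E * ((e1 s)%:E + (e2 s)%:E))%E.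
  by rewrite -EFinD -EFinM lee_fin.
rewrite -!(ExD w_ge0)//; last by move=> s; rewrite adde_ge0.
apply: le_Ex => // s _; rewrite -!(EFinD, EFinM) lee_fin.
have := dil s; rewrite ler_norml => /andP[_ ?].
have := expR_truncate_le (k * (D s - n%:R * b)) M0.
by rewrite (mulrA 2) -/(e1 s) (mulrC (e1 s)); lra.
Qed.

End Truncation.

(** * Gaussian exponential moments *)

Section Gaussian.
Context {R : realType}.
Local Notation mu := (@lebesgue_measure R).

Lemma expR_normal_pdf (s c x : R) : s != 0 ->
  expR (c * x) * normal_pdf 0 s x =
  expR (c ^+ 2 * s ^+ 2 / 2) * normal_pdf (c * s ^+ 2) s x.
Proof.
move=> s0; rewrite !normal_pdfE//= /normal_fun !mulrA !(mulrC (expR _) (normal_peak s)).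
rewrite -!mulrA; congr (_ * _); rewrite -!expRD; congr expR.
by rewrite subr0 -mulr_natr; field.
Qed.

Lemma integral_expR_normal_pdf (s c : R) : s != 0 ->
  (\int[mu]_x (expR (c * x) * normal_pdf 0 s x)%:E = (expR (c ^+ 2 * s ^+ 2 / 2))%:E)%E.
Proof.
move=> s0.
under eq_integral do rewrite (expR_normal_pdf c _ s0) EFinM.
rewrite ge0_integralZl_EFin ?expR_ge0//.
- by rewrite integral_normal_pdf mule1.
- by move=> x _; rewrite lee_fin normal_pdf_ge0.
- by apply/measurable_EFinP; exact: measurable_normal_pdf.
Qed.

Lemma continuous_truncated_expR (e M : R) : continuous (fun x : R => Num.min (expR (e * x)) M).
Proof.
move=> x; apply: (@continuous_min R R (fun x => expR (e * x)) (fun=> M) x); last exact: cvg_cst.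
apply: continuous_comp; last exact: continuous_expR.
by apply: continuousM; [exact: cvg_cst|exact: cvg_id].
Qed.

(** The loss [expR (2 * sigma2) / M] is the Gaussian moment at [2 * e] entering [expR_truncate_le].
    For [sigma2 = 0] the law is a Dirac mass and the bound is numerical. *)
Lemma gauss_expect_truncated_expR (sigma2 e M : R) : 0 <= sigma2 -> e ^+ 2 = 1 -> 0 < M ->
  ((expR (sigma2 / 2) - expR (2 * sigma2) / M)%:E <=
     gauss_expect sigma2 (fun x => Num.min (expR (e * x)) M)
   <= (expR (sigma2 / 2))%:E)%E.
Proof.
move=> s20 e1 M0; rewrite /gauss_expect; case: eqVneq => [->|sN0].
  rewrite !(mulr0, mul0r) expR0 !lee_fin ge_min lexx andbT.
  case: (leP 1 M) => [M1|M1]; first by rewrite gerBl divr_ge0// ltW.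
  rewrite lerBlDr -(ler_pM2r M0) mulrDl divfK ?gt_eqF//; nra.
set s := Num.sqrt sigma2.
have ss : s ^+ 2 = sigma2 by rewrite sqr_sqrtr.
have s0 : s != 0 by rewrite /s sqrtr_eq0 -ltNge lt0r sN0.
pose f x := Num.min (expR (e * x)) M * normal_pdf 0 s x.
pose g c x := expR (c * x) * normal_pdf 0 s x.
have min0 x : 0 <= Num.min (expR (e * x)) M by rewrite le_min expR_ge0 ltW.
have f0 x : 0 <= f x by rewrite mulr_ge0// normal_pdf_ge0.
have g0 c x : 0 <= g c x by rewrite mulr_ge0 ?expR_ge0// normal_pdf_ge0.
have mf : measurable_fun setT f.
  have mmin := continuous_measurable_fun (continuous_truncated_expR (e := e) (M := M)).
  exact: measurable_funM mmin (measurable_normal_pdf 0 s).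
have mg c : measurable_fun setT (g c).
  apply: measurable_funM; last exact: measurable_normal_pdf.
  apply: measurableT_comp => //; exact: measurable_funM.
have Eg c : (\int[mu]_x (g c x)%:E = (expR (c ^+ 2 * sigma2 / 2))%:E)%E.
  by rewrite -ss; exact: integral_expR_normal_pdf.
rewrite -[X in (_ <= X <= _)%E]/(\int[mu]_x (f x)%:E)%E.
have mEf : measurable_fun setT (fun x => (f x)%:E) by exact/measurable_EFinP.
have mEg c : measurable_fun setT (fun x => (g c x)%:E).
  by apply/measurable_EFinP; exact: mg.
have Ef0 x : setT x -> (0 <= (f x)%:E)%E by rewrite lee_fin.
have Eg0 c x : setT x -> (0 <= (g c x)%:E)%E by rewrite lee_fin.
have e2 : expR (sigma2 / 2) = expR (e ^+ 2 * sigma2 / 2) by rewrite e1 mul1r.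
apply/andP; split; last first.
  rewrite e2 -Eg; apply: ge0_le_integral => //; [exact: (mEg e)|move=> x _].
  by rewrite lee_fin ler_wpM2r ?normal_pdf_ge0// ge_min lexx.
rewrite EFinB leeBlDr//.
have Mi0 : 0 <= M^-1 by rewrite invr_ge0 ltW.
have EM0 x : setT x -> (0 <= M^-1%:E * (g (2 * e) x)%:E)%E.
  by rewrite -EFinM lee_fin mulr_ge0.
have mEM : measurable_fun setT (fun x => M^-1%:E * (g (2 * e) x)%:E)%E.
  by apply: measurable_funeM; exact: mEg.
have -> : (expR (2 * sigma2) / M)%:E = (\int[mu]_x (M^-1%:E * (g (2 * e) x)%:E))%E.
  rewrite ge0_integralZl_EFin//; [|by move=> x _; rewrite lee_fin|exact: (mEg (2 * e))].
  rewrite Eg -EFinM exprMn e1; congr _%:E; rewrite [RHS]mulrC.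
  by congr (expR _ / M); field.
have <- : (\int[mu]_x ((f x)%:E + M^-1%:E * (g (2 * e) x)%:E) =
    \int[mu]_x (f x)%:E + \int[mu]_x (M^-1%:E * (g (2 * e) x)%:E))%E.
  by rewrite ge0_integralD.
rewrite e2 -Eg.
apply: ge0_le_integral => //; [|exact: (mEg e)| |].
- by move=> x _; rewrite lee_fin.
- by apply: emeasurable_funD; [exact: mEf|exact: mEM].
move=> x _; rewrite -EFinM -EFinD lee_fin /g /f mulrA -mulrDl.
rewrite ler_wpM2r ?normal_pdf_ge0// [_^-1 * _]mulrC -mulrA.
exact: expR_truncate_le.
Qed.
End Gaussian.

(** * Second order expansion at 0 *)

Section SecondOrderExpansion.
Context {R : realType} {X : Type} (d : X -> X -> R) (o : X).
Context (gs gi : nat -> X -> X) (w : nat -> R) (alpha m a A b ell sigma2 : R).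
Hypothesis dm : is_metric d.
Hypothesis gsd : forall k x y, d (gs k x) (gs k y) = d x y.
Hypothesis giK : forall k, cancel (gi k) (gs k).
Hypothesis w_ge0 : forall k, 0 <= w k.
Hypothesis w_sum1 : (\sum_(0 <= k <oo) (w k)%:E = 1)%E.
Hypothesis alpha_gt0 : 0 < alpha.
Hypothesis um : (E1 w (fun k => (expR (alpha * d (gs k o) o))%:E) = m%:E)%E.
Hypothesis a_gt0 : 0 < a.
Hypothesis tail : forall n y,
  (Ex w n (fun s => (expR (a * gromov_product d o y (act gs s o)))%:E) <= A%:E)%E.

Local Notation act := (act gs).
Local Notation D s := (d (act s o) o).
Local Notation G := (2 * (A / a)).

Hypothesis bP : forall n, n%:R * b <= rex w n (fun s => D s) <= n%:R * b + G.

Local Notation phi := (phi d o gs w b).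
Local Notation Kb := (phi_bound d o gs w alpha m a A).
Local Notation err := (mult_error d o gs w alpha m a A).
Local Notation laplace := (laplace d o gs w b).
Local Notation trexp e M := (fun x : R => Num.min (expR (e * x)) M).

Definition clt_mean e M n : R :=
  rex w n (fun s => trexp e M ((D s - n%:R * ell) / Num.sqrt n%:R)).

Hypothesis sigma2_ge0 : 0 <= sigma2.
Hypothesis clt : forall e M, e ^+ 2 = 1 -> 0 < M ->
  Ex w n (fun s => (trexp e M ((D s - n%:R * ell) / Num.sqrt n%:R))%:E) @[n --> \oo]
  --> gauss_expect sigma2 (trexp e M).

Lemma clt_mean_cvg e M : e ^+ 2 = 1 -> 0 < M ->
  exists2 r : R, clt_mean e M n @[n --> \oo] --> r &
    expR (sigma2 / 2) - expR (2 * sigma2) / M <= r <= expR (sigma2 / 2).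
Proof.
move=> e1 M0; have /andP[lo hi] := gauss_expect_truncated_expR sigma2_ge0 e1 M0.
have gfin : gauss_expect sigma2 (trexp e M) \is a fin_num.
  rewrite fin_numE; apply/andP; split; apply/eqP => gE.
    by move: lo; rewrite gE leeNy_eq.
  by move: hi; rewrite gE leye_eq.
exists (fine (gauss_expect sigma2 (trexp e M))).
  by apply: fine_cvg; rewrite fineK//; exact: clt.
by rewrite -!lee_fin fineK// lo hi.
Qed.

Let sqrt_large (B : R) : \forall n \near \oo, B <= Num.sqrt (n%:R : R).
Proof.
near=> n; have Bn : B ^+ 2 <= n%:R by near: n; exact: nbhs_infty_ger.
by rewrite (le_trans (ler_norm B))// -sqrtr_sqr ler_wsqrtr.
Unshelve. all: by end_near.
Qed.

(** If the two differed, then for the sign [e] making [e * (b - ell)] negative, the truncated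
    exponential of the normalized distance would have mean tending to 0 by the bound on [phi], while
    its Gaussian limit is positive. *)
Lemma drift_unique : ell = b.
Proof.
apply/eqP; apply: contraT => /eqP nlb.
pose e : R := if b < ell then 1 else -1.
have e1 : e ^+ 2 = 1 by rewrite /e; case: ifP => _; rewrite ?sqrrN expr1n.
have ne : `|e| = 1 by rewrite /e; case: ifP => _; rewrite ?normrN normr1.
pose kap := `|b - ell|.
have kap0 : 0 < kap by rewrite normr_gt0 subr_eq0; apply/eqP => /esym.
have ekap : e * (b - ell) = - kap.
  rewrite /e /kap; case: ifPn => [lt|]; first by rewrite ltr0_norm ?subr_lt0//; ring.
  by rewrite -leNgt => le; rewrite ger0_norm ?subr_ge0//; ring.
pose c := expR (sigma2 / 2); have c0 : 0 < c := expR_gt0 _.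
(* With this level the truncation loss is exactly [c / 2]. *)
pose M := 2 * expR (2 * sigma2) / c.
have M0 : 0 < M by rewrite divr_gt0// mulr_gt0 ?expR_gt0.
have [r /cvgrPdist_le cr /andP[lo _]] := clt_mean_cvg e1 M0.
have {}lo : c / 2 <= r.
  apply: le_trans lo; rewrite -/c /M.
  have -> : expR (2 * sigma2) / (2 * expR (2 * sigma2) / c) = c / 2.
    by field; rewrite !gt_eqF ?expR_gt0.
  by lra.
have c4 : 0 < c / 4 by rewrite divr_gt0.
near \oo => n.
have rn : `|r - clt_mean e M n| <= c / 4 by near: n; exact: cr.
have n0 : (0 < n)%N by near: n; exact: nbhs_infty_gt.
have sn0 : 0 < Num.sqrt n%:R :> R by rewrite sqrtr_gt0 ltr0n.
have sn2 : Num.sqrt n%:R ^+ 2 = n%:R :> R by rewrite sqr_sqrtr.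
pose k := e / Num.sqrt n%:R.
have nk : `|k| = (Num.sqrt n%:R)^-1.
  by rewrite normrM ne mul1r normfV ger0_norm// ltW.
have ka : `|k| <= alpha / 6.
  rewrite nk -[leRHS]invrK lef_pV2 ?posrE ?invr_gt0 ?divr_gt0//.
  by near: n; exact: sqrt_large.
have k2n : k ^+ 2 * n%:R <= 8.
  rewrite /k exprMn e1 exprVn sn2 mul1r mulVf ?pnatr_eq0 ?gtn_eqF//; lra.
have up : clt_mean e M n <= expR (- (kap * Num.sqrt n%:R)) * Kb.
  apply: (@le_trans _ _ (expR (- (kap * Num.sqrt n%:R)) * phi n k)); last first.
    rewrite ler_wpM2l ?expR_ge0//.
    exact: (phi_le dm gsd giK w_ge0 w_sum1 alpha_gt0 um a_gt0 tail bP).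
  rewrite -lee_fin EFinM -(Ex_phi dm gsd giK w_ge0 w_sum1 alpha_gt0 um a_gt0 tail bP)//.
  rewrite -ExZ ?expR_ge0//.
  rewrite -(Ex_min_expR w_ge0 w_sum1)//; apply: le_Ex => // s _.
    by rewrite lee_fin le_min expR_ge0 ltW.
  rewrite -EFinM -expRD lee_fin ge_min; apply/orP; left; rewrite ler_expR.
  have -> : kap = - (e * (b - ell)) by rewrite ekap opprK.
  rewrite /k le_eqVlt; apply/orP; left; apply/eqP.
  move: sn0 sn2; move: (Num.sqrt n%:R) => q q0 <-.
  by field; rewrite gt_eqF.
have small : expR (- (kap * Num.sqrt n%:R)) * Kb <= c / 8.
  have Kb0 : 0 < Kb := expR_gt0 _.
  rewrite expRN -ler_pdivlMr// -[leRHS]invrK lef_pV2 ?posrE ?expR_gt0 ?invr_gt0 ?divr_gt0//.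
  apply: (@le_trans _ _ (kap * Num.sqrt n%:R)); last first.
    by have := expR_ge1Dx (kap * Num.sqrt n%:R); lra.
  rewrite -ler_pdivrMl//; near: n; exact: sqrt_large.
by move: rn; rewrite ler_norml => /andP[? ?]; lra.
Unshelve. all: by end_near.
Qed.

(** All values considered are at least 1/2, where the logarithm has slope at most 2. *)
Lemma log_near_bounds (S eta p : R) : 0 <= S -> 0 <= eta <= 1 / 2 ->
  expR S - eta <= p <= expR S + eta -> 0 < p /\ `|ln p - S| <= 2 * eta.
Proof.
move=> S0 /andP[e0 e1] /andP[p1 p2].
have E1 : 1 <= expR S by rewrite -expR0 ler_expR.
have p0 : 0 < p by lra.
split=> //; have lnS : ln (expR (S + 2 * eta)) = S + 2 * eta by rewrite expRK.
have lnS' : ln (expR (S - 2 * eta)) = S - 2 * eta by rewrite expRK.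
rewrite ler_norml; apply/andP; split.
  rewrite lerBrDl -lnS' ?ler_ln ?posrE ?expR_gt0//; last first.
    rewrite expRD expRN ler_pdivrMr ?expR_gt0//.
    have := expR_ge1Dx (2 * eta); nra.
rewrite lerBlDl -lnS ler_ln ?posrE ?expR_gt0//.
by rewrite expRD; have := expR_ge1Dx (2 * eta); nra.
Qed.

Lemma sqrt_window (t y : R) : 0 <= t -> y <= 1 -> 1 <= t ^+ 2 <= 1 + y ->
  1 <= t <= 3 / 2 /\ t - 1 <= y.
Proof.
move=> t0 y1 /andP[h1 h2]; have t1 : 1 <= t by nra.
by split; [apply/andP; split|]; nra.
Qed.

(** Four quarters of [eta]: the dilation [u], the two truncations [v + y], the central limit theorem
    and the multiplicative error [c]. *)
Lemma perturbed_window (p t E u v y c eta : R) :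
  `|p - t| <= u + v -> `|t - E| <= eta / 4 + y -> u <= eta / 4 -> v + y = eta / 4 ->
  0 <= c <= eta / 4 ->
  E - eta <= p - c <= E + eta /\ E - eta <= p + c <= E + eta.
Proof.
rewrite !ler_norml => /andP[? ?] /andP[? ?] ? ? /andP[? ?].
by split; apply/andP; split; lra.
Qed.

Lemma scaled_window (V S y kap eps eta x1 x2 : R) :
  0 <= S -> x1 <= V <= x2 -> `|x1 - S| <= 2 * eta -> `|x2 - S| <= 2 * eta ->
  eta <= eps / 8 -> y * S <= eps / 2 -> 1 <= kap <= 1 + y -> `|kap * S - V| <= eps.
Proof.
move=> S0 /andP[V1 V2]; rewrite !ler_norml => /andP[? ?] /andP[? ?] ? ? /andP[k1 k2].
have : 0 <= (kap - 1) * S by rewrite mulr_ge0// subr_ge0.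
have : (kap - 1) * S <= y * S by rewrite ler_wpM2r// lerBlDl.
by move=> ? ?; apply/andP; split; lra.
Qed.

(** With [N] the first integer above [l ^- 2], [l] is [t * k] where [k] is [1 / sqrt N] up to sign
    and [t] is close to 1, so [phi N l] is close to an expectation governed by the central limit
    theorem. *)
Lemma log_laplace_expansion (eps : R) : 0 < eps ->
  \forall l \near 0^', forall L : R,
    ln (laplace l n) / n%:R @[n --> \oo] --> L ->
    `|sigma2 / 2 - (L - l * ell) / l ^+ 2| <= eps.
Proof.
move=> eps0; rewrite drift_unique.
pose S := sigma2 / 2; have S0 : 0 <= S by rewrite divr_ge0.
pose eta := Num.min (1 / 2) (eps / 8).
have eta0 : 0 < eta by rewrite lt_min !divr_gt0.
have eta1 : 0 <= eta <= 1 / 2 by rewrite (ltW eta0) ge_min lexx.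
have eta2 : eta <= eps / 8 by rewrite ge_min lexx orbT.
have Kb0 : 0 < Kb := expR_gt0 _.
have err0 : 0 <= err := mult_error_ge0 alpha m a_gt0 tail.
(* The truncation losses of the walk and of the Gaussian law then add up to [eta / 4]. *)
pose M := (Kb + expR (2 * sigma2)) / (eta / 4).
have M0 : 0 < M by rewrite divr_gt0 ?addr_gt0 ?expR_gt0 ?divr_gt0.
have eta4 : 0 < eta / 4 by rewrite divr_gt0.
have KM : Kb / M + expR (2 * sigma2) / M = eta / 4.
  rewrite -mulrDl /M; field; rewrite !gt_eqF// ?addr_gt0 ?expR_gt0//.
have gclt e : e ^+ 2 = 1 -> \forall n \near \oo, `|truncated d o gs w b (e / Num.sqrt n%:R) M n - expR S|
    <= eta / 4 + expR (2 * sigma2) / M.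
  move=> e1; have [r /cvgrPdist_le cr /andP[lo hi]] := clt_mean_cvg e1 M0.
  near=> n; have : `|r - clt_mean e M n| <= eta / 4 by near: n; exact: cr.
  have -> : clt_mean e M n = truncated d o gs w b (e / Num.sqrt n%:R) M n.
    rewrite /clt_mean /truncated drift_unique; congr (rex w n _); apply/funext => s.
    by congr (Num.min (expR _) M); ring.
  move: lo hi; rewrite -/S !ler_norml => lo hi /andP[h1 h2].
  have : 0 <= expR (2 * sigma2) / M by rewrite divr_ge0 ?expR_ge0// ltW.
  by move: (expR (2 * sigma2) / M) lo => x lo x0; apply/andP; split; lra.
(* One test function for each sign of [l]; both are controlled before [l] is chosen. *)
have [n1 _ gn1] := gclt 1 (expr1n _ _).
have [n2 _ gn2] := gclt (-1) (etrans (sqrrN _) (expr1n _ _)).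
near=> l => L zL.
have l0 : l != 0 by near: l; exact: nbhs_dnbhs_neq.
have lpos : 0 < `|l| by rewrite normr_gt0.
have la0 c : 0 < c -> \forall l \near 0^', `|l| <= c by move=> c0; exact: dnbhs0_le.
have l1 : `|l| <= 1 by near: l; exact: dnbhs0_le.
have la1 : `|l| <= alpha / 12 by near: l; apply: dnbhs0_le; rewrite divr_gt0.
have la2 : `|l| <= a / 8 by near: l; apply: dnbhs0_le; rewrite divr_gt0.
have ln12 : `|l| <= ((n1 + n2).+1%:R)^-1 by near: l; apply: dnbhs0_le; rewrite invr_gt0.
have lK : `|l| <= eta / (16 * Kb) by near: l; apply: dnbhs0_le; rewrite divr_gt0// mulr_gt0.
have lerr : `|l| <= eta / (4 * (err + 1)).
  by near: l; apply: dnbhs0_le; rewrite divr_gt0// mulr_gt0// ltr_wpDl.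
have lS : `|l| <= eps / (2 * (S + 1)).
  by near: l; apply: dnbhs0_le; rewrite divr_gt0// mulr_gt0// ltr_wpDl.
have l2 : l ^+ 2 <= `|l| by rewrite -real_normK ?num_real// expr2 ler_piMl.
have l20 : 0 < l ^+ 2 by rewrite exprn_even_gt0.
(* Rounding [l ^- 2] upwards ensures [1 <= t], as the dilation bound requires, and leaves
   [N%:R * l ^+ 2] within [l ^+ 2] of 1. *)
have [N0 /andP[N1 N2]] : exists N0 : nat, N0%:R <= (l ^+ 2)^-1 < N0.+1%:R.
  by exists (Num.trunc (l ^+ 2)^-1); rewrite truncn_itv// invr_ge0 ltW.
set N := N0.+1 in N2.
have Nl1 : 1 < N%:R * l ^+ 2 by rewrite -ltr_pdivrMr// div1r.
have Nl2 : N%:R * l ^+ 2 <= 1 + l ^+ 2.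
  by rewrite -natr1 mulrDl mul1r lerD2r -ler_pdivlMr// div1r.
have NR0 : 0 < N%:R :> R by rewrite ltr0n.
have sN0 : 0 < Num.sqrt N%:R :> R by rewrite sqrtr_gt0.
have sN2 : Num.sqrt N%:R ^+ 2 = N%:R :> R by rewrite sqr_sqrtr// ltW.
have Nn : (n1 + n2 <= N)%N.
  have h : (n1 + n2).+1%:R <= (l ^+ 2)^-1.
    by rewrite -[leLHS]invrK lef_pV2 ?posrE ?invr_gt0// (le_trans l2).
  by rewrite -(ler_nat R) (le_trans _ (ltW N2))// (le_trans _ h)// ler_nat.
have [e e1 le] : exists2 e : R, e = 1 \/ e = -1 & l = e * `|l|.
  by case: (ltrgt0P l) l0 => // h _; [exists 1|exists (-1)]; rewrite ?mul1r ?mulN1r ?opprK; auto.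
pose t := `|l| * Num.sqrt N%:R; pose k := e / Num.sqrt N%:R.
have tt : t ^+ 2 = N%:R * l ^+ 2 by rewrite exprMn real_normK ?num_real// sN2 mulrC.
have t0 : 0 <= t by rewrite mulr_ge0// ltW.
have [t12 tl] : 1 <= t <= 3 / 2 /\ t - 1 <= `|l|.
  by apply: sqrt_window => //; rewrite tt (ltW Nl1) (le_trans Nl2)// lerD2l.
have t1 : 1 <= t by case/andP: t12.
have lk : l = t * k by rewrite {1}le /t /k; field; rewrite gt_eqF.
have e2 : e ^+ 2 = 1 by case: e1 => ->; rewrite ?sqrrN expr1n.
have ne : `|e| = 1 by case: e1 => ->; rewrite ?normrN normr1.
have nk : `|k| <= `|l|.
  have -> : `|l| = t * `|k| by rewrite {1}lk (normrM t k) (ger0_norm t0).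
  by rewrite ler_peMl.
have kN : k ^+ 2 * N%:R <= 2.
  by rewrite /k exprMn e2 exprVn sN2 mul1r mulVf ?gt_eqF// ler1n.
have gN : `|truncated d o gs w b k M N - expR S| <= eta / 4 + expR (2 * sigma2) / M.
  case: e1 => e1; rewrite /k e1; [apply: gn1|apply: gn2] => /=.
    by rewrite (leq_trans _ Nn)// leq_addr.
  by rewrite (leq_trans _ Nn)// leq_addl.
have := phi_truncated dm gsd giK w_ge0 w_sum1 alpha_gt0 um a_gt0 tail bP t12 M0
  (le_trans nk la1) kN.
rewrite -lk => pN.
have tK : (t - 1) * (4 * Kb) <= eta / 4.
  apply: (@le_trans _ _ (`|l| * (4 * Kb))); first by rewrite ler_wpM2r// mulr_ge0// ltW.
  rewrite (le_trans (ler_wpM2r _ lK)) ?mulr_ge0 ?(ltW Kb0)//.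
  have -> : eta / (16 * Kb) * (4 * Kb) = eta / 4 by field; rewrite gt_eqF.
  by [].
have lE : `|l| * err <= eta / 4.
  apply: (@le_trans _ _ (eta / (4 * (err + 1)) * (err + 1))).
    by rewrite ler_pM// lerDl.
  have -> : eta / (4 * (err + 1)) * (err + 1) = eta / 4.
    by field; rewrite gt_eqF// ltr_wpDl.
  by [].
have le0 : 0 <= `|l| * err <= eta / 4 by rewrite mulr_ge0.
have [lo hi] := perturbed_window pN gN tK KM le0.
have [plo Vlo] := log_near_bounds S0 eta1 lo.
have [_ Vhi] := log_near_bounds S0 eta1 hi.
have lN2 : l ^+ 2 * N%:R <= 2.
  by rewrite mulrC (le_trans Nl2)// (natrD R 1 1) lerD2l (le_trans l2).
have V12 := laplace_bounds dm gsd giK w_ge0 w_sum1 alpha_gt0 um a_gt0 tail bP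
  la1 la2 lN2 isT zL plo.
set V := N%:R * (L - l * b) in V12.
have -> : (L - l * b) / l ^+ 2 = V / (N%:R * l ^+ 2).
  by rewrite /V; field; rewrite l0 gt_eqF.
have kp0 : 0 < N%:R * l ^+ 2 by rewrite mulr_gt0.
have -> : S - V / (N%:R * l ^+ 2) = (N%:R * l ^+ 2 * S - V) / (N%:R * l ^+ 2).
  by field; rewrite l0 gt_eqF.
rewrite normrM normfV (gtr0_norm kp0) ler_pdivrMr//.
have Sl : l ^+ 2 * S <= eps / 2.
  apply: (@le_trans _ _ (eps / (2 * (S + 1)) * (S + 1))).
    by rewrite ler_pM ?(ltW l20) ?(le_trans l2)// lerDl.
  have -> : eps / (2 * (S + 1)) * (S + 1) = eps / 2.
    by field; rewrite gt_eqF// ltr_wpDl.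
  by [].
have kap12 : 1 <= N%:R * l ^+ 2 <= 1 + l ^+ 2 by rewrite Nl2 ltW.
rewrite (le_trans (scaled_window S0 V12 Vlo Vhi eta2 Sl kap12))//.
by rewrite ler_peMr ?ltW.
Unshelve. all: by end_near.
Qed.

End SecondOrderExpansion.

Theorem theorem1p1
  (R : realType) (X : Type) (d : X -> X -> R) (o : X)
  (gs : nat -> X -> X) (w : nat -> R)
  (dT : measure_display) (T : measurableType dT) (P : probability T R)
  (K : nat -> T -> nat) (ell sigma2 : R) :
  is_metric d -> geodesic_space d -> gromov_hyperbolic d ->
  count_prob d gs w -> non_elementary d o gs w -> exp_moment d o gs w ->
  iid_indices P w K ->
  (* ell is the drift: a.s. limit of d(z_n,o)/n *)
  {ae P, forall t, (fun n : nat => d (walk gs K o n t) o / n%:R) @ \oo --> ell} ->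
  (* sigma2 is the CLT variance: (d(z_n,o) - n ell)/sqrt n converges in law to N(0,sigma2) *)
  0 <= sigma2 ->
  (forall f : R -> R, continuous f -> (exists M : R, forall x, `|f x| <= M) ->
     (fun n : nat =>
        (\int[P]_t (f ((d (walk gs K o n t) o - n%:R * ell) / Num.sqrt n%:R))%:E)%E)
       @ \oo --> gauss_expect sigma2 f) ->
  ((Lambda d o gs P K lam - (lam * ell)%:E) * (lam ^- 2)%:E)%E @[lam --> 0^']
    --> (sigma2 / 2)%:E.
Proof.
move=> dm _ hyp [iso [w0 w1]] ne em iid _ s0 clt.
have gsd k : forall x y, d (gs k x) (gs k y) = d x y by case: (iso k).
have inv k : exists h, cancel (gs k) h /\ cancel h (gs k).
  by have [[h hK Kh] _] := iso k; exists h.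
have [gi giP] := boolp.choice inv.
have gsK k : cancel (gs k) (gi k) by case: (giP k).
have giK k : cancel (gi k) (gs k) by case: (giP k).
have [a [A [a0 tail]]] := gromov_product_exp_moment dm hyp gsd gsK giK w0 w1 ne em.
have [alpha [m [alpha0 um]]] := exp_moment_E1 w0 em.
have [b bP] := mean_dist_drift dm gsd giK w0 w1 alpha0 um a0 tail.
(* The truncated exponential is continuous and bounded by [M], hence an admissible test function. *)
have clt' e M : e ^+ 2 = 1 -> 0 < M ->
    Ex w n (fun s => (Num.min (expR (e * ((d (act gs s o) o - n%:R * ell) / Num.sqrt n%:R))) M)%:E)
    @[n --> \oo] --> gauss_expect sigma2 (fun x => Num.min (expR (e * x)) M).
  move=> _ M0; have min0 x : 0 <= Num.min (expR (e * x)) M by rewrite le_min expR_ge0 ltW.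
  have := clt _ (continuous_truncated_expR (e := e) (M := M)) _.
  rewrite (_ : (fun n => _) = (fun n =>
      Ex w n (fun s => (Num.min (expR (e * ((d (act gs s o) o - n%:R * ell) / Num.sqrt n%:R))) M)%:E))).
    apply; exists M => x; rewrite ger0_norm// ge_min lexx orbT//.
  apply/funext => n; rewrite -(integral_word w0 iid) => [|s]; last by rewrite lee_fin.
  by apply: eq_integral => t _; rewrite walk_word.
have LamE l : `|l| <= alpha / 6 -> exists2 L, Lambda d o gs P K l = L%:E &
    ln (laplace d o gs w b l n) / n%:R @[n --> \oo] --> L.
  move=> la; have [L zL] := laplace_cvg dm gsd giK w0 w1 alpha0 um a0 tail bP la.
  exists L => //; apply: (Lambda_walk w0 iid _ _ zL) => n.
    exact: (Ex_laplace dm gsd giK w0 w1 alpha0 um a0 tail bP).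
  exact: (laplace_gt0 dm gsd giK w0 w1 alpha0 um a0 tail bP).
have near_la : \forall l \near (0 : R)^', `|l| <= alpha / 6 by apply: dnbhs0_le; rewrite divr_gt0.
apply: cvg_EFin.
  near=> l; have [|L -> _] := LamE l; first by near: l.
  by rewrite -EFinB -EFinM.
apply/cvgrPdist_le => eps eps0; near=> l.
have [|L LE zL] := LamE l; first by near: l.
rewrite /= LE -EFinB -EFinM /=; move: L zL {LE}; near: l.
exact: (log_laplace_expansion dm gsd giK w0 w1 alpha0 um a0 tail bP s0 clt' eps0).
Unshelve. all: by end_near.
Qed.
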